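(* Consider the equation \[ \phi_t=\partial_{xx}\phi-(\partial_x\phi)^2+\varepsilon g(x),\qquad x\in\mathbb{R}, \] where $g$ satisfies: for some $\sigma>2$, $\int(\partial_x^jg(x))^2(1+x^2)^{\sigma+4}\,\mathrm{d}x<\infty$ for $j=0,1,2$, and $g_0:=\int g\,\mathrm{d}x\neq 0$; let $g_1:=\int xg(x)\,\mathrm{d}x$ and $\omega_{\mathrm{nl}}(k)=k^2$. Then there exists $\varepsilon_0>0$ such that for all $0<|\varepsilon|<\varepsilon_0$ with $\mathrm{sign}(\varepsilon)=-\mathrm{sign}(g_0)$ there is a solution of the form \[ \Phi(x,t;\varepsilon)=\phi(x;\varepsilon)+\big(\phi_0(\varepsilon)+k(\varepsilon)x\big)\tanh(x)-\omega_{\mathrm{nl}}(k(\varepsilon))\,t, \] where $\phi_0,k$ are $C^1$ in $\varepsilon$ with $\phi_0'(0)=\tfrac12 g_1$, $k'(0)=-\tfrac12 g_0$, and $|\phi(x;\varepsilon)|\to0$ as $|x|\to\infty$, uniformly in $\varepsilon$. *)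

(* Defs.v *)
From HB Require Import structures.
From mathcomp Require Import all_boot all_order all_algebra.
From mathcomp Require Import all_classical all_reals all_analysis.
Set Implicit Arguments. Unset Strict Implicit. Unset Printing Implicit Defensive.
Import Order.TTheory GRing.Theory Num.Theory.
Import numFieldNormedType.Exports.
Local Open Scope classical_set_scope.
Local Open Scope ring_scope.

Section Defs.
Variable R : realType.

Definition tanh (x : R) : R := (expR x - expR (- x)) / (expR x + expR (- x)).

Definition omega_nl (k : R) : R := k ^+ 2.

Definition weighted_L2 (w : R) (f : R -> R) : Prop :=
  measurable_fun setT f /\
  (\int[lebesgue_measure]_(x in setT) ((f x) ^+ 2 * (1 + x ^+ 2) `^ w)%:E < +oo)%E.

(* [df] is a (weak) derivative of [f] on R: [df] is locally Lebesgue
   integrable and f is its indefinite integral (f absolutely continuous on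
   bounded intervals with a.e. derivative df) *)
Definition weak_deriv (f df : R -> R) : Prop :=
  forall a b : R, a <= b ->
    lebesgue_measure.-integrable `[a, b] (EFin \o df) /\
    f b - f a = Rintegral lebesgue_measure `[a, b] df.

(* f is C^1 on the set J (used for intervals), with derivative f' :
   difference quotients within J converge to f' and f' is continuous
   within J (one-sided at endpoints belonging to J) *)
Definition C1_on (J : set R) (f f' : R -> R) : Prop :=
  forall x, J x ->
    (forall e : R, 0 < e -> exists2 d : R, 0 < d & forall y, J y ->
        `|y - x| < d -> y != x -> `|(f y - f x) / (y - x) - f' x| < e) /\
    (forall e : R, 0 < e -> exists2 d : R, 0 < d & forall y, J y ->
        `|y - x| < d -> `|f' y - f' x| < e).

Definition dx (Phi : R -> R -> R) (x t : R) : R := derive1 (fun y => Phi y t) x.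
Definition dt (Phi : R -> R -> R) (x t : R) : R := derive1 (fun s => Phi x s) t.

Definition classical_solution (eps : R) (g : R -> R) (Phi : R -> R -> R) : Prop :=
  forall x t : R,
    derivable (fun s => Phi x s) t 1 /\
    derivable (fun y => Phi y t) x 1 /\
    derivable (fun y => dx Phi y t) x 1 /\
    dt Phi x t = derive1 (fun y => dx Phi y t) x - (dx Phi x t) ^+ 2 + eps * g x.

End Defs.

(* Main.v *)
(* The ansatz reduces the equation to the Riccati equation u' = u^2 - k^2 - eps g
   for u = Phi_x, with u -> k at +oo and u -> -k at -oo.  On each half-line
   u = k + a (resp. -k - a after reflection), where a is the fixed point of
   a(x) = int_x^oo exp(-2k(y-x)) (eps g(y) - a(y)^2) dy; the two halves match at 0
   when 2k = -(a_+(0) + a_-(0)), and 2 phi0 is the difference of the integrals of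
   a_+ and a_-.  For small eps, k, a_+ and a_- come from one contraction in weighted
   sup norms, which also shows that they are Lipschitz in eps.  The difference of two
   solutions a1, a2 for the parameters eps1, eps2 solves a linear equation and is
   (eps1 - eps2) P - 2 (k1 - k2) Q with explicit integrals P and Q.  Hence the
   divided differences of k and phi0 extend to Lipschitz functions of (eps1, eps2)
   up to the diagonal, including eps = 0, and k and phi0 are C^1. *)

Require Import Defs.
From HB Require Import structures.
From mathcomp Require Import all_boot all_order all_algebra.
From mathcomp Require Import all_classical all_reals all_analysis.
From mathcomp Require Import measurable_realfun ring lra.
Set Implicit Arguments. Unset Strict Implicit. Unset Printing Implicit Defensive.
Import Order.TTheory GRing.Theory Num.Theory.
Import numFieldNormedType.Exports.
Local Open Scope classical_set_scope.
Local Open Scope ring_scope.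

(** * Continuity and derivative combinators *)

(** At [k = 0] the kernel [exp(-2k(y-x))] stops decaying, and for [k < 0] it grows. No exponential
    weight survives as eps tends to 0, so all decay has to come from the moments of [g], measured in
    powers of [om x = 1/(1+|x|)], and the problem is posed only on the side of 0 where [k >= 0].
    This is where the sign condition enters: to first order [k] is [-eps g0/2].

    Thus [eps = 0] is a boundary point of the parameter set, and differentiating the kernel in [k]
    costs a factor [y - x], so the derivative lives in a weaker weighted space than the solution.
    The powers of [om] form a ladder for this reason: 5 for the invariant ball, 4 for the
    contraction, 3 and then 2 for the response to a change of [k] and for its variation. Divided
    differences avoid differentiating the fixed-point map altogether: they are given by integrals
    for which Lipschitz bounds suffice, and their values on the diagonal are the derivatives, at the
    endpoint 0 too. *)

Section Continuity.
Context {R : realType}.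
Implicit Types F G : R -> R.

Lemma contC (c : R) : continuous (fun _ : R => c).
Proof. by move=> x; exact: cvg_cst. Qed.

Lemma cont_id : continuous (fun x : R => x).
Proof. by move=> x; exact: cvg_id. Qed.

Lemma contD F G : continuous F -> continuous G -> continuous (fun x => F x + G x).
Proof. by move=> cF cG x; apply: cvgD; [exact: cF|exact: cG]. Qed.

Lemma contB F G : continuous F -> continuous G -> continuous (fun x => F x - G x).
Proof. by move=> cF cG x; apply: cvgB; [exact: cF|exact: cG]. Qed.

Lemma contM F G : continuous F -> continuous G -> continuous (fun x => F x * G x).
Proof. by move=> cF cG x; apply: cvgM; [exact: cF|exact: cG]. Qed.

Lemma cont_comp F G : continuous F -> continuous G -> continuous (fun x => F (G x)).
Proof.
by move=> cF cG x; apply: (@continuous_comp _ _ _ G F); [exact: cG|exact: cF].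
Qed.

Lemma contX F n : continuous F -> continuous (fun x => F x ^+ n).
Proof. by apply: (@cont_comp (fun y => y ^+ n)); exact: exprn_continuous. Qed.

Lemma cont_norm F : continuous F -> continuous (fun x => `|F x|).
Proof. by apply: (@cont_comp Num.norm); exact: norm_continuous. Qed.

Lemma cont_expR F : continuous F -> continuous (fun x => expR (F x)).
Proof. by apply: (@cont_comp expR); exact: continuous_expR. Qed.

Lemma is_derive_cont F (f : R -> R) :
  (forall x : R, is_derive x 1 F (f x)) -> continuous F.
Proof.
move=> dF x; apply/differentiable_continuous/derivable1_diffP.
exact: (@ex_derive _ _ _ _ _ _ _ (dF x)).
Qed.

End Continuity.

(** * Integrals over half-lines *)

Section Tail.
Context {R : realType}.
Notation mu := (@lebesgue_measure R).
Implicit Types (F G : R -> R) (x y c : R).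

Definition tail F x : R := (\int[mu]_(y in `[x, +oo[) F y)%R.

(** Integrability is asked on the right half-line only, the left one being reached by reflection.
    Continuity on the whole line makes [tail F] differentiable from both sides at 0, as the gluing
    there requires. *)
Definition tame F := continuous F /\ mu.-integrable `[0, +oo[ (EFin \o F).

Lemma continuous_itv_integrable F a b : continuous F ->
  mu.-integrable `[a, b] (EFin \o F).
Proof.
move=> cF; apply: continuous_compact_integrable; first exact: segment_compact.
exact: continuous_subspaceT.
Qed.

Lemma continuous_integrable_setU F (A B : set R) : continuous F ->
  measurable A -> measurable B -> [disjoint A & B] ->
  mu.-integrable A (EFin \o F) -> mu.-integrable B (EFin \o F) ->
  mu.-integrable (A `|` B) (EFin \o F).
Proof.
move=> cF mA mB AB /integrableP[_ iA] /integrableP[_ iB].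
have mF : measurable_fun setT F by exact: continuous_measurable_fun.
have mE : measurable_fun setT (EFin \o F) by exact/measurable_EFinP.
apply/integrableP; split; first exact: measurable_funTS.
rewrite ge0_integral_setU//=; last first.
  by apply: measurable_funTS; apply/measurable_EFinP; exact: measurableT_comp.
exact: lte_add_pinfty.
Qed.

Lemma tame_integrable F c : tame F -> mu.-integrable `[c, +oo[ (EFin \o F).
Proof.
move=> [cF iF]; have [c0|c0] := leP 0 c.
  apply: integrableS iF => //.
  by apply: subset_itvr; rewrite bnd_simp.
rewrite (@itv_bndbnd_setU _ _ _ (BLeft 0)) ?bnd_simp//; last exact: ltW.
apply: continuous_integrable_setU => //.
- apply/disj_setPS => y [/=]; rewrite 2!in_itv/= => /andP[_ yx] /andP[].
  by rewrite leNgt yx.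
- apply: integrableS (continuous_itv_integrable c 0 cF) => //.
  by apply: subset_itvl; rewrite bnd_simp.
Qed.

Lemma tail_split F a b : tame F -> a <= b ->
  tail F a = (\int[mu]_(y in `[a, b]) F y)%R + tail F b.
Proof.
move=> tF ab; have iF := tame_integrable a tF.
rewrite /tail -[X in _ = _ + X]Rintegral_itv_obnd_cbnd; last first.
  by apply: integrableS iF => //; apply: subset_itvr; rewrite bnd_simp.
rewrite -(Rintegral_itvB iF (x := b)) ?bnd_simp//.
by rewrite addrC subrK.
Qed.

Lemma is_derive_tail F x : tame F -> is_derive x 1 (tail F) (- F x).
Proof.
move=> tF; have cF := tF.1.
(* A base point strictly left of [x] makes [x] interior to [[c, x + 1]]; near [x] the tail is a
   constant minus an integral from [c]. *)
pose c := x - 1.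
have cx : c < x by rewrite /c ltrBlDr ltrDl.
pose H (z : R) := tail F c - (\int[mu]_(y in `[c, z]) F y)%R.
have xx1 : x < x + 1 by rewrite ltrDl.
have [dI I'] := @continuous_FTC1_closed R F c x (x + 1) xx1
  (continuous_itv_integrable c (x + 1) cF) cx (cF x).
have dH : is_derive x 1 H (- F x).
  rewrite -(add0r (- F x)); apply: is_deriveB.
  by apply: DeriveDef; [exact: dI|rewrite -derive1E I'].
apply: (near_eq_is_derive _ dH).
near=> z; rewrite /H (@tail_split F c z)//; first by rewrite addrAC subrr add0r.
apply/ltW; near: z; exact: lt_nbhsr.
Unshelve. all: by end_near. Qed.

Lemma tame_dom F G : continuous F -> tame G ->
  (forall y, 0 <= y -> `|F y| <= G y) -> tame F.
Proof.
move=> cF [cG iG] FG; split => //; apply: le_integrable iG => //.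
  apply/measurable_EFinP/measurable_funTS.
  exact: continuous_measurable_fun.
move=> y; rewrite /= in_itv/= andbT => y0.
by rewrite lee_fin (le_trans (FG _ y0))// ler_norm.
Qed.

Lemma tameZ c F : tame F -> tame (fun y => c * F y).
Proof.
move=> [cF iF]; split; first exact: contM (@contC _ c) cF.
exact: (integrableZl _ c iF).
Qed.

Lemma tameD F G : tame F -> tame G -> tame (fun y => F y + G y).
Proof.
move=> [cF iF] [cG iG]; split; first exact: contD.
exact: (integrableD _ iF iG).
Qed.

Lemma tameB F G : tame F -> tame G -> tame (fun y => F y - G y).
Proof.
move=> [cF iF] [cG iG]; split; first exact: contB.
exact: (integrableB _ iF iG).
Qed.

Lemma tailZ c F x : tame F -> tail (fun y => c * F y) x = c * tail F x.
Proof. by move=> /(tame_integrable x) iF; rewrite /tail RintegralZl. Qed.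

Lemma tailB F G x : tame F -> tame G ->
  tail (fun y => F y - G y) x = tail F x - tail G x.
Proof.
move=> /(tame_integrable x) iF /(tame_integrable x) iG.
by rewrite /tail RintegralB.
Qed.

Lemma eq_tail F G x : (forall y, x <= y -> F y = G y) -> tail F x = tail G x.
Proof.
move=> FG; apply: eq_Rintegral => y.
by rewrite inE/= in_itv/= andbT => /FG.
Qed.

Lemma norm_tail_le F G x : tame F -> tame G ->
  (forall y, x <= y -> `|F y| <= G y) -> `|tail F x| <= tail G x.
Proof.
move=> /(tame_integrable x) iF /(tame_integrable x) iG FG.
apply: (le_trans (le_normr_Rintegral _ iF)) => //.
apply: le_Rintegral => //.
  exact: (integrable_norm iF).
by move=> y /=; rewrite in_itv/= andbT => /FG.
Qed.

Lemma tail_ge0 F x : (forall y, x <= y -> 0 <= F y) -> 0 <= tail F x.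
Proof.
by move=> F0; apply: Rintegral_ge0 => y /=; rewrite in_itv/= andbT => /F0.
Qed.

End Tail.

(** * The polynomial weight and elementary estimates *)

Section Weight.
Context {R : realType}.
Implicit Types (x y : R).

Definition om x : R := (1 + `|x|)^-1.

Lemma om_gt0 x : 0 < om x.
Proof. by rewrite invr_gt0 ltr_pwDl. Qed.

Lemma om_ge0 x : 0 <= om x. Proof. exact/ltW/om_gt0. Qed.

Lemma om_le1 x : om x <= 1.
Proof. by rewrite invf_le1 ?ltr_pwDl// lerDl. Qed.

Lemma om_norm x : om `|x| = om x. Proof. by rewrite /om normr_id. Qed.

Lemma omX_ge0 x n : 0 <= om x ^+ n. Proof. exact/exprn_ge0/om_ge0. Qed.

Lemma omX_le x m n : (n <= m)%N -> om x ^+ m <= om x ^+ n.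
Proof. by move=> nm; apply: ler_wiXn2l => //; [exact: om_ge0|exact: om_le1]. Qed.

Lemma omX_le1 x n : om x ^+ n <= 1.
Proof. by apply: exprn_ile1; [exact: om_ge0|exact: om_le1]. Qed.

Lemma omX_decr x y n : 0 <= x -> x <= y -> om y ^+ n <= om x ^+ n.
Proof.
move=> x0 xy; have y0 := le_trans x0 xy.
apply: lerXn2r; rewrite ?nnegrE ?om_ge0//.
by rewrite /om !ger0_norm// lef_pV2 ?posrE ?ltr_pwDl// lerD2l.
Qed.

Lemma om_mul x n : 0 <= x -> (1 + x) * om x ^+ n.+1 = om x ^+ n.
Proof.
by move=> x0; rewrite exprS /om ger0_norm// mulrA divff ?mul1r// gt_eqF// ltr_pwDl.
Qed.

Lemma continuous_om : continuous (om : R -> R).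
Proof.
move=> x; apply: cvgV; first by rewrite gt_eqF// ltr_pwDl.
by apply: cvgD; [exact: cvg_cst|exact: norm_continuous].
Qed.

Lemma continuous_omX n : continuous (fun x => om x ^+ n).
Proof. exact/contX/continuous_om. Qed.

Lemma expR_half : expR (1 / 2) <= 2 :> R.
Proof.
have := expR_ge1Dx (- (1 / 2) : R); rewrite expRN => h.
have e0 := expR_gt0 (1 / 2 : R).
rewrite -[leLHS]invrK invf_ple ?posrE ?invr_gt0//.
by apply: le_trans h; lra.
Qed.

(** Only upper bounds on the exponents are at hand, since [-2k(y-x)] is unbounded below. For
    [a <= b] the difference is [exp b (1 - exp(a-b))], at most [2 (b - a)]. *)
Lemma expR_lip a b : a <= 1 / 2 -> b <= 1 / 2 ->
  `|expR a - expR b| <= 2 * `|a - b| :> R.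
Proof.
wlog ab : a b / a <= b => [hw a2 b2|_ b2].
  have [ab|/ltW ba] := leP a b; first exact: hw.
  by rewrite distrC (distrC a); exact: hw.
rewrite (@ler0_norm _ (expR a - _)) ?subr_le0 ?ler_expR//.
rewrite (@ler0_norm _ (a - b)) ?subr_le0// !opprB.
have -> : expR b - expR a = expR b * (1 - expR (a - b)).
  by rewrite mulrBr mulr1 -expRD; congr (_ - expR _); ring.
have h := expR_ge1Dx (a - b).
apply: ler_pM; [exact: expR_ge0| | |].
- by rewrite subr_ge0 -expR0 ler_expR subr_le0.
- by apply: le_trans expR_half; rewrite ler_expR.
- by lra.
Qed.

(** [D] is constant on the half-line by the mean value theorem, and the only constant that decays is
    0. Two explicit formulas rest on this: the one for the difference of two solutions and the one
    for an iterated tail. *)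
Lemma derive0_decay (D : R -> R) C x :
  (forall z : R, 0 <= z -> is_derive z 1 D 0) ->
  (forall z, 0 <= z -> `|D z| <= C * om z) -> 0 <= x -> D x = 0.
Proof.
move=> dD DC x0.
have Dc z : x < z -> D z = D x.
  move=> xz; have := @MVT R D (fun=> 0) x z xz.
  case.
  - move=> t; rewrite in_itv/= => /andP[xt _].
    by apply: dD; rewrite (le_trans x0)// ltW.
  - apply/continuous_in_subspaceT => t; rewrite inE/= in_itv/= => /andP[xt _].
    apply/differentiable_continuous/derivable1_diffP.
    exact: (@ex_derive _ _ _ _ _ _ _ (dD t (le_trans x0 xt))).
  - by move=> c _ /eqP; rewrite mul0r subr_eq0 => /eqP.
have C0 : 0 <= C.
  have := DC 0 (lexx 0); rewrite /om normr0 addr0 invr1 mulr1.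
  exact: le_trans.
apply/eqP; rewrite -normr_le0 leNgt; apply/negP => D0.
(* Chosen so that [C < |D x| (1 + z)], against the decay bound at [z]. *)
pose z := x + C / `|D x| + 1.
have xz : x < z by rewrite /z -addrA ltrDl ltr_wpDl// divr_ge0.
have z0 : 0 <= z by rewrite (le_trans x0)// ltW.
have := DC z z0; rewrite (Dc z xz) leNgt => /negP; apply.
rewrite /om ger0_norm// ltr_pdivrMr; last by rewrite ltr_pwDl.
rewrite -ltr_pdivrMl// mulrC /z.
by rewrite -!addrA; lra.
Qed.

Lemma tame_norm F : tame F -> tame (fun y => `|F y| : R).
Proof.
move=> [cF iF]; split; last exact: (integrable_norm iF).
exact: cont_norm.
Qed.

End Weight.

(** * The linear half-line problem *)

Section Resolvent.
Context {R : realType} (B : R -> R) (be : R).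
Hypotheses (tB : tame B) (Bom : forall y, om y ^+ 2 <= B y).
Hypothesis hbe : 2 * tail B 0 <= be.
Implicit Types (k x y c : R) (S f F : R -> R).

Lemma B_ge0 y : 0 <= B y. Proof. by apply: le_trans (Bom y); exact: omX_ge0. Qed.

Lemma tail_B_le x : 0 <= x -> tail B x <= be / 2.
Proof.
move=> x0; have := tail_split tB x0.
have : 0 <= (\int[@lebesgue_measure R]_(y in `[0, x]) B y)%R.
  by apply: Rintegral_ge0 => y _; exact: B_ge0.
by move: hbe => /[swap]; lra.
Qed.

(** [om] decreases on the half-line, so its power leaves the integral at the left end [x], and the
    integrable weight [B] carries the rest. The half in [be / 2] is there to absorb the bound 2 on
    the kernel. *)
Lemma tail_le n c F x : tame F -> 0 <= x -> 0 <= c ->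
  (forall y, x <= y -> `|F y| <= c * om y ^+ n * B y) ->
  `|tail F x| <= c * om x ^+ n * (be / 2).
Proof.
move=> tF x0 c0 FB.
have := @norm_tail_le _ F (fun y => (c * om x ^+ n) * B y) x tF (tameZ _ tB).
rewrite tailZ// => /(_ _)/le_trans; apply.
  move=> y xy; apply: (le_trans (FB y xy)).
  by rewrite ler_wpM2r ?B_ge0// ler_wpM2l// omX_decr.
by rewrite ler_wpM2l ?tail_B_le// mulr_ge0// omX_ge0.
Qed.

Lemma tame_le c F : continuous F -> (forall y, 0 <= y -> `|F y| <= c * B y) ->
  tame F.
Proof. by move=> cF FB; apply: tame_dom cF (tameZ c tB) FB. Qed.

(* The decaying solution w of w' = (2k - S') w - f, i.e. the integral over y >= x of
   exp(S y - S x - 2k(y - x)) f y, written with a separated kernel. *)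
Definition resolv k S f x : R :=
  expR (2 * k * x - S x) * tail (fun y => expR (S y - 2 * k * y) * f y) x.

(** The bound [1 / 4] gives [S y - S x <= 1/2], hence a kernel of size at most [exp(1/2) <= 2],
    uniformly in [k >= 0]. *)
Definition small S := continuous S /\ forall y, 0 <= y -> `|S y| <= 1 / 4.

Lemma tame_resolv k S f : 0 <= k -> small S -> tame f ->
  tame (fun y => expR (S y - 2 * k * y) * f y).
Proof.
move=> k0 [cS S4] tf; have cf := tf.1.
apply: (tame_dom _ (tameZ 2 (tame_norm tf))).
  apply: contM cf; apply: cont_expR; apply: contB => //.
  exact: contM (@contC _ _) cont_id.
move=> y y0; rewrite normrM ler_wpM2r// ger0_norm ?expR_ge0//.
apply: le_trans expR_half; rewrite ler_expR.
have := S4 y y0; rewrite ler_norml => /andP[_].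
have : 0 <= 2 * k * y by rewrite !mulr_ge0.
by lra.
Qed.

Lemma resolvE k S f x : 0 <= k -> small S -> tame f ->
  resolv k S f x = tail (fun y => expR (S y - S x - 2 * k * (y - x)) * f y) x.
Proof.
move=> k0 sS tf; rewrite /resolv -tailZ; last exact: tame_resolv.
by apply: eq_tail => y _; rewrite mulrA -expRD; congr (expR _ * _); ring.
Qed.

Lemma tame_kernel k S f x : 0 <= k -> small S -> tame f ->
  tame (fun y => expR (S y - S x - 2 * k * (y - x)) * f y).
Proof.
move=> k0 sS tf.
have := tameZ (expR (2 * k * x - S x)) (tame_resolv k0 sS tf).
congr tame; apply/funext => y.
by rewrite mulrA -expRD; congr (expR _ * _); ring.
Qed.

Lemma kernel_exponent_le k S x y : 0 <= k -> small S -> 0 <= x -> x <= y ->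
  S y - S x - 2 * k * (y - x) <= 1 / 2.
Proof.
move=> k0 [_ S4] x0 xy.
have := S4 y (le_trans x0 xy); rewrite ler_norml => /andP[_].
have := S4 x x0; rewrite ler_norml => /andP[+ _].
have : 0 <= 2 * k * (y - x) by rewrite !mulr_ge0// subr_ge0.
by lra.
Qed.

Lemma kernel_le2 k S x y : 0 <= k -> small S -> 0 <= x -> x <= y ->
  expR (S y - S x - 2 * k * (y - x)) <= 2.
Proof.
move=> k0 sS x0 xy; apply: le_trans expR_half.
by rewrite ler_expR kernel_exponent_le.
Qed.

Lemma resolv_le n c k S f x : 0 <= k -> small S -> tame f -> 0 <= x -> 0 <= c ->
  (forall y, 0 <= y -> `|f y| <= c * om y ^+ n * B y) ->
  `|resolv k S f x| <= c * be * om x ^+ n.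
Proof.
move=> k0 sS tf x0 c0 fB; rewrite resolvE//.
have c20 : 0 <= 2 * c by rewrite mulr_ge0.
have h y : x <= y -> `|expR (S y - S x - 2 * k * (y - x)) * f y| <=
    (2 * c) * om y ^+ n * B y.
  move=> xy; rewrite normrM (ger0_norm (expR_ge0 _)).
  have -> : 2 * c * om y ^+ n * B y = 2 * (c * om y ^+ n * B y) by ring.
  apply: ler_pM; rewrite ?expR_ge0 ?kernel_le2//.
  exact/fB/(le_trans x0).
apply: (le_trans (tail_le (tame_kernel x k0 sS tf) x0 c20 h)).
by lra.
Qed.

(** Because of the term [2 (k1 - k2)(y - x)] the two kernels differ by a multiple of [1 + y], which
    one power of [om] in the bound on [f1] absorbs: [n.+1] there becomes [n] in the conclusion. The
    difference [f1 - f2] meets only a bounded kernel and loses nothing. *)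
Lemma resolv_dist n c d dk dS k1 k2 S1 S2 f1 f2 x :
  0 <= k1 -> 0 <= k2 -> small S1 -> small S2 -> tame f1 -> tame f2 ->
  0 <= x -> 0 <= c -> 0 <= d -> `|k1 - k2| <= dk ->
  (forall y, 0 <= y -> `|S1 y - S2 y| <= dS) ->
  (forall y, 0 <= y -> `|f1 y| <= c * om y ^+ n.+1 * B y) ->
  (forall y, 0 <= y -> `|f1 y - f2 y| <= d * om y ^+ n * B y) ->
  `|resolv k1 S1 f1 x - resolv k2 S2 f2 x| <=
    (c * (2 * dk + 2 * dS) + d) * be * om x ^+ n.
Proof.
move=> k10 k20 s1 s2 t1 t2 x0 c0 d0 hk hS hf hd.
have dk0 : 0 <= dk by exact: le_trans hk.
have dS0 : 0 <= dS by apply: le_trans (hS 0 (lexx 0)).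
set e := c * (2 * dk + 2 * dS) + d.
have e0 : 0 <= e by rewrite addr_ge0// mulr_ge0// addr_ge0// mulr_ge0.
rewrite !resolvE// -tailB; [|exact: tame_kernel..].
have tt := tameB (tame_kernel x k10 s1 t1) (tame_kernel x k20 s2 t2).
have e20 : 0 <= 2 * e by rewrite mulr_ge0.
apply: (le_trans (tail_le (n := n) tt x0 e20 _)); last by lra.
move=> y xy; have y0 := le_trans x0 xy.
set z1 := S1 y - S1 x - 2 * k1 * (y - x).
set z2 := S2 y - S2 x - 2 * k2 * (y - x).
have -> : expR z1 * f1 y - expR z2 * f2 y =
    (expR z1 - expR z2) * f1 y + expR z2 * (f1 y - f2 y) by ring.
apply: (le_trans (ler_normD _ _)); rewrite !normrM (ger0_norm (expR_ge0 _)).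
have hz : `|expR z1 - expR z2| <= 2 * ((2 * dk + 2 * dS) * (1 + y)).
  apply: (le_trans (expR_lip _ _)); [exact: kernel_exponent_le..|].
  rewrite ler_wpM2l//.
  have -> : z1 - z2 = (S1 y - S2 y) - (S1 x - S2 x) - 2 * (k1 - k2) * (y - x).
    by rewrite /z1 /z2; ring.
  apply: (le_trans (ler_normB _ _)).
  have := ler_normB (S1 y - S2 y) (S1 x - S2 x).
  have := hS y y0; have := hS x x0.
  rewrite !normrM (@ger0_norm _ (y - x)) ?subr_ge0// ger0_norm//.
  have : 2 * `|k1 - k2| * (y - x) <= 2 * dk * (1 + y).
    by apply: ler_pM; [rewrite mulr_ge0|rewrite subr_ge0|rewrite ler_wpM2l|lra].
  have : 2 * dS <= 2 * dS * (1 + y) by rewrite ler_peMr ?mulr_ge0//; lra.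
  by lra.
have h1 : `|expR z1 - expR z2| * `|f1 y| <=
    2 * (c * (2 * dk + 2 * dS)) * om y ^+ n * B y.
  apply: (le_trans (ler_pM _ _ hz (hf y y0))) => //.
  by rewrite -(om_mul n y0) le_eqVlt; apply/orP; left; apply/eqP; ring.
have h2 : expR z2 * `|f1 y - f2 y| <= 2 * d * om y ^+ n * B y.
  have -> : 2 * d * om y ^+ n * B y = 2 * (d * om y ^+ n * B y) by ring.
  by apply: ler_pM; rewrite ?expR_ge0 ?kernel_le2 ?hd.
apply: (le_trans (lerD h1 h2)).
by rewrite /e le_eqVlt; apply/orP; left; apply/eqP; ring.
Qed.

Lemma is_derive_resolv k S f x (s : R) : 0 <= k -> small S -> tame f ->
  is_derive x 1 S s ->
  is_derive x 1 (resolv k S f) ((2 * k - s) * resolv k S f x - f x).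
Proof.
move=> k0 sS tf dS.
have dT := is_derive_tail x (tame_resolv k0 sS tf).
have dL : is_derive x 1 (fun y => 2 * k * y - S y) (2 * k - s).
  apply: is_deriveB.
  apply: (is_derive_eq (is_deriveZ (2 * k) (is_derive_id x 1))).
  by rewrite /GRing.scale/= mulr1.
have dE := is_derive1_comp (is_derive_expR _) dL.
apply: (is_derive_eq (is_deriveM dE dT)).
rewrite /resolv /GRing.scale/= !mulrN.
have -> : expR (S x - 2 * k * x) = (expR (2 * k * x - S x))^-1.
  by rewrite -expRN opprB.
have := lt0r_neq0 (expR_gt0 (2 * k * x - S x)).
set E := expR _ => E0; set T := tail _ _.
by rewrite mulVKf//; ring.
Qed.

Lemma continuous_resolv k S f : 0 <= k -> small S -> tame f ->
  continuous (resolv k S f).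
Proof.
move=> k0 sS tf; apply: contM.
  apply: cont_expR; apply: contB sS.1; exact: contM (@contC _ _) cont_id.
exact: is_derive_cont (fun x => is_derive_tail x (tame_resolv k0 sS tf)).
Qed.

End Resolvent.

(** * Divided differences and gluing *)

Section DividedDifferences.
Context {R : realType} (J : set R).
Implicit Types (p q : R -> R -> R) (f : R -> R).

(** Boundedness is included because products of Lipschitz functions need it; the diagonal belongs to
    the domain because derivatives are read off there. *)
Definition lip2 q := exists M : R, [/\ 0 <= M,
  forall x y, J x -> J y -> `|q x y| <= M &
  forall x y x' y', J x -> J y -> J x' -> J y' ->
    `|q x y - q x' y'| <= M * (`|x - x'| + `|y - y'|)].

Lemma lip2_cst (c : R) : lip2 (fun _ _ => c).
Proof.
exists `|c|; split => // x y x' y' _ _ _ _.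
by rewrite subrr normr0 mulr_ge0// addr_ge0.
Qed.

Lemma lip2B p q : lip2 p -> lip2 q -> lip2 (fun x y => p x y - q x y).
Proof.
move=> [M [M0 bM lM]] [N [N0 bN lN]]; exists (M + N); split.
- exact: addr_ge0.
- move=> x y Jx Jy; apply: (le_trans (ler_normB _ _)).
  by apply: lerD; [exact: bM|exact: bN].
- move=> x y x' y' Jx Jy Jx' Jy'; rewrite mulrDl.
  have -> : p x y - q x y - (p x' y' - q x' y') =
    (p x y - p x' y') - (q x y - q x' y') by ring.
  apply: (le_trans (ler_normB _ _)).
  by apply: lerD; [exact: lM|exact: lN].
Qed.

Lemma lip2M p q : lip2 p -> lip2 q -> lip2 (fun x y => p x y * q x y).
Proof.
move=> [M [M0 bM lM]] [N [N0 bN lN]]; exists (2 * (M * N) + M * N); split.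
- by rewrite addr_ge0 ?mulr_ge0.
- move=> x y Jx Jy; rewrite normrM.
  apply: (@le_trans _ _ (M * N)); last by have := mulr_ge0 M0 N0; lra.
  by apply: ler_pM => //; [exact: bM|exact: bN].
- move=> x y x' y' Jx Jy Jx' Jy'.
  have -> : p x y * q x y - p x' y' * q x' y' =
    (p x y - p x' y') * q x y + p x' y' * (q x y - q x' y') by ring.
  apply: (le_trans (ler_normD _ _)); rewrite !normrM.
  set D := `|x - x'| + `|y - y'|.
  have D0 : 0 <= D by rewrite addr_ge0.
  have h1 : `|p x y - p x' y'| * `|q x y| <= M * D * N.
    by apply: ler_pM => //; [exact: lM|exact: bN].
  have h2 : `|p x' y'| * `|q x y - q x' y'| <= M * (N * D).
    by apply: ler_pM => //; [exact: bM|exact: lN].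
  have : 0 <= M * N * D by rewrite !mulr_ge0.
  by lra.
Qed.

Lemma lip2V q : lip2 q -> (forall x y, J x -> J y -> 1 <= q x y) ->
  lip2 (fun x y => (q x y)^-1).
Proof.
move=> [M [M0 bM lM]] q1; exists (M + 1).
have V1 x y : J x -> J y -> `|(q x y)^-1| <= 1.
  move=> Jx Jy; have := q1 x y Jx Jy => h.
  by rewrite ger0_norm ?invr_ge0 ?(le_trans _ h)// invf_le1// (lt_le_trans _ h).
split.
- exact: addr_ge0.
- by move=> x y Jx Jy; apply: (le_trans (V1 _ _ Jx Jy)); rewrite lerDr.
- move=> x y x' y' Jx Jy Jx' Jy'.
  have n1 : q x y != 0 by rewrite gt_eqF// (lt_le_trans _ (q1 _ _ Jx Jy)).
  have n2 : q x' y' != 0 by rewrite gt_eqF// (lt_le_trans _ (q1 _ _ Jx' Jy')).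
  have -> : (q x y)^-1 - (q x' y')^-1 =
    (q x' y' - q x y) * ((q x y)^-1 * (q x' y')^-1) by field; rewrite n1 n2.
  rewrite normrM; apply: (@le_trans _ _ (`|q x' y' - q x y| * 1)).
    rewrite ler_wpM2l// normrM -[leRHS]mulr1.
    by apply: ler_pM => //; exact: V1.
  rewrite mulr1 distrC; apply: (le_trans (lM _ _ _ _ Jx Jy Jx' Jy')).
  by rewrite ler_wpM2r ?addr_ge0// lerDl.
Qed.

(** Off the diagonal [q] is the difference quotient, so by continuity its diagonal value is the
    derivative. As [J] is an arbitrary set, one-sided derivatives at an endpoint are covered. *)
Lemma C1_divdiff f q : lip2 q ->
  (forall x y, J x -> J y -> f x - f y = q x y * (x - y)) ->
  C1_on J f (fun x => q x x).
Proof.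
move=> [M [M0 _ lM]] fq x Jx.
(* The 2 covers the motion of both arguments in [q y y - q x x]; the added 1 keeps the divisor
   positive when [M = 0]. *)
have M1 : 0 < 2 * M + 1 by rewrite ltr_wpDl// mulr_ge0.
have dM (e y : R) : 0 < e -> `|y - x| < e / (2 * M + 1) -> 2 * M * `|y - x| < e.
  move=> e0; rewrite ltr_pdivlMr// => h.
  by have := normr_ge0 (y - x); lra.
split=> e e0; exists (e / (2 * M + 1)); rewrite ?divr_gt0// => y Jy yx.
- move=> nyx; rewrite fq// mulfK ?subr_eq0//.
  apply: le_lt_trans (dM e y e0 yx); apply: (le_trans (lM _ _ _ _ Jy Jx Jx Jx)).
  rewrite subrr normr0 addr0 ler_wpM2r//; lra.
- apply: le_lt_trans (dM e y e0 yx); apply: (le_trans (lM _ _ _ _ Jy Jy Jx Jx)).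
  by rewrite le_eqVlt; apply/orP; left; apply/eqP; ring.
Qed.

Lemma C1_on_subset (J' : set R) f f' : J' `<=` J -> C1_on J f f' -> C1_on J' f f'.
Proof.
move=> JJ cf x /JJ/cf [h1 h2]; split=> e e0.
- by have [d d0 hd] := h1 e e0; exists d => // y /JJ; exact: hd.
- by have [d d0 hd] := h2 e e0; exists d => // y /JJ; exact: hd.
Qed.

End DividedDifferences.

Section Glue.
Context {R : realType}.
Implicit Types (f g : R -> R) (x : R).

Definition glue0 f g x := if 0 <= x then f x else g x.

(** Both pieces have two-sided derivatives at 0, so each one-sided quotient of the glued function is
    the restriction of one of theirs. *)
Lemma is_derive_glue0 f g (df dg : R -> R) x :
  (forall z : R, 0 <= z -> is_derive z 1 f (df z)) ->
  (forall z : R, z <= 0 -> is_derive z 1 g (dg z)) ->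
  f 0 = g 0 -> df 0 = dg 0 ->
  is_derive x 1 (glue0 f g) (glue0 df dg x).
Proof.
move=> hf hg fg0 dfg0.
have [x0|x0|->] := ltgtP x 0.
- rewrite /glue0 leNgt x0/=; apply: near_eq_is_derive (hg x (ltW x0)).
  near=> z; rewrite /glue0 leNgt (_ : z < 0)//; near: z; exact: lt_nbhsl.
- rewrite /glue0 (ltW x0); apply: near_eq_is_derive (hf x (ltW x0)).
  near=> z; rewrite /glue0 ltW//; near: z; exact: lt_nbhsr.
have quot (F : R -> R) (d : R) : is_derive (0 : R) 1 F d ->
    h^-1 *: ((F \o shift 0) (h *: (1 : R)) - F 0) @[h --> 0^'] --> d.
  by move=> [dF <-]; exact: dF.
have H : h^-1 *: ((glue0 f g \o shift 0) (h *: (1 : R)) - glue0 f g 0) @[h --> 0^'] -->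
    glue0 df dg 0.
  pose q (h : R) : R := h^-1 *: ((glue0 f g \o shift 0) (h *: (1 : R)) - glue0 f g 0).
  apply: (@cvg_at_right_left_dnbhs _ R^o); rewrite /q /glue0 lexx.
  - apply: cvg_trans (cvg_dnbhs_at_right (quot _ _ (hf 0 (lexx 0)))).
    apply: near_eq_cvg; near=> h; have h0 : 0 < h by near: h; exact: nbhs_right_gt.
    by rewrite /= addr0 /GRing.scale/= mulr1 ltW.
  - rewrite dfg0 fg0; apply: cvg_trans (cvg_dnbhs_at_left (quot _ _ (hg 0 (lexx 0)))).
    apply: near_eq_cvg; near=> h; have h0 : h < 0 by near: h; exact: nbhs_left_lt.
    by rewrite /= addr0 /GRing.scale/= mulr1 leNgt h0.
by apply: DeriveDef; [exact: cvgP H|exact: cvg_lim H].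
Unshelve. all: by end_near. Qed.

End Glue.

(** * Limits with a geometric rate *)

Section Geometric.
Context {R : realType}.
Implicit Types (x y c e : R) (u : nat -> R).

Lemma geometric_small c e : 0 < e -> exists n, c / 2 ^+ n < e.
Proof.
move=> e0; have [c0|c0] := leP c 0.
  by exists 0%N; rewrite expr0 divr1; exact: le_lt_trans e0.
exists (Num.truncn (c / e)).+1; set n := (Num.truncn _).+1.
rewrite ltr_pdivrMr ?exprn_gt0// -ltr_pdivrMl// mulrC.
apply: (@lt_trans _ _ n%:R); first exact: truncnS_gt.
by rewrite -natrX ltr_nat ltn_expl.
Qed.

Lemma le_geometric x y c : (forall n, x <= y + c / 2 ^+ n) -> x <= y.
Proof.
move=> h; apply/ler_addgt0Pr => e /(geometric_small c)[n hn].
by apply: (le_trans (h n)); rewrite lerD2l ltW.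
Qed.

(** Nested intervals: the remainder of the series from [n] on is [2c/2^n], so the lower ends
    [u n - 2c/2^n] increase and the upper ends [u n + 2c/2^n] decrease. The supremum of the lower
    ends lies in every interval, which gives the limit together with its rate. *)
Lemma geometric_cauchy u c : (forall n, `|u n.+1 - u n| <= c / 2 ^+ n) ->
  exists l, forall n, `|u n - l| <= 2 * c / 2 ^+ n.
Proof.
move=> h.
have c0 : 0 <= c by have := h 0%N; rewrite expr0 divr1; exact: le_trans.
have half n : 2 * c / 2 ^+ n.+1 = c / 2 ^+ n.
  by rewrite exprS; field; rewrite expf_neq0.
have twice n : 2 * c / 2 ^+ n = c / 2 ^+ n + c / 2 ^+ n by rewrite -mulrA mulr_natl mulr2n.
pose v n := u n - 2 * c / 2 ^+ n.
pose w n := u n + 2 * c / 2 ^+ n.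
have vS n : v n <= v n.+1.
  by rewrite /v half twice; have := h n; rewrite ler_norml => /andP[]; lra.
have wS n : w n.+1 <= w n.
  by rewrite /w half twice; have := h n; rewrite ler_norml => /andP[]; lra.
have vm n m : (n <= m)%N -> v n <= v m.
  by elim: m => [|m IH]; [rewrite leqn0 => /eqP ->|
    rewrite leq_eqVlt => /orP[/eqP -> //|/IH/le_trans]; apply].
have wm n m : (n <= m)%N -> w m <= w n.
  elim: m => [|m IH]; first by rewrite leqn0 => /eqP ->.
  by rewrite leq_eqVlt => /orP[/eqP -> //|/IH]; apply: le_trans.
have vw n m : v n <= w m.
  apply: (le_trans (vm n (maxn n m) (leq_maxl _ _))).
  apply: (le_trans _ (wm m (maxn n m) (leq_maxr _ _))).
  have c2 : 0 <= 2 * c / 2 ^+ maxn n m by rewrite divr_ge0 ?mulr_ge0// exprn_ge0.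
  by rewrite /v /w; lra.
have ubv m : ubound (range v) (w m) by move=> _ [n _ <-]; exact: vw.
exists (sup (range v)) => n.
have : v n <= sup (range v).
  by apply: ub_le_sup; [exists (w 0%N); exact: ubv|exists n].
have : sup (range v) <= w n.
  by apply: ge_sup; [exists (v 0%N); exists 0%N|exact: ubv].
by rewrite /v /w ler_norml; lra.
Qed.

Lemma continuous_geometric_limit (f : nat -> R -> R) (l : R -> R) c :
  (forall n, continuous (f n)) ->
  (forall n x, `|f n x - l x| <= c / 2 ^+ n) -> continuous l.
Proof.
move=> cf fl x; apply/cvgrPdist_lt => e e0.
have e30 : 0 < e / 3 by rewrite divr_gt0.
have [n hn] := geometric_small c e30.
have /cvgrPdist_lt/(_ _ e30) := cf n x.
apply: filterS => y hy.
have := fl n x; have := fl n y; rewrite distrC => h1 h2.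
have -> : l x - l y = (f n x - f n y) - (f n x - l x) + (f n y - l y) by ring.
apply: (le_lt_trans (ler_normD _ _)).
apply: (@le_lt_trans _ _ (`|f n x - f n y| + `|f n x - l x| + `|f n y - l y|)).
  by rewrite lerD2r ler_normB.
by rewrite (distrC (f n y)); lra.
Qed.

End Geometric.

(** * Linearity and sign of the resolvent *)

Section ResolventAlgebra.
Context {R : realType}.
Implicit Types (k x c : R) (S f : R -> R).

Lemma resolv_lin k S f1 f2 c1 c2 x : 0 <= k -> small S -> tame f1 -> tame f2 ->
  resolv k S (fun y => c1 * f1 y - c2 * f2 y) x =
  c1 * resolv k S f1 x - c2 * resolv k S f2 x.
Proof.
move=> k0 sS t1 t2; have r1 := tame_resolv k0 sS t1; have r2 := tame_resolv k0 sS t2.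
rewrite /resolv !(mulrCA _ (expR _)) -mulrBr; congr (_ * _).
rewrite -!tailZ// -tailB; [|exact: tameZ..].
by apply: eq_tail => y _; ring.
Qed.

Lemma resolv_ge0 k S f x : (forall y, x <= y -> 0 <= f y) -> 0 <= resolv k S f x.
Proof.
move=> f0; rewrite mulr_ge0 ?expR_ge0//; apply: tail_ge0 => y xy.
by rewrite mulr_ge0 ?expR_ge0 ?f0.
Qed.

(** The reference operator in the sign argument for [k] and in the computation of the derivatives at
    [eps = 0]. *)
Lemma resolv00 f x : resolv 0 (fun=> 0) f x = tail f x.
Proof.
rewrite /resolv mulr0 mul0r subr0 expR0 mul1r.
by apply: eq_tail => y _; rewrite mul0r subr0 expR0 mul1r.
Qed.

End ResolventAlgebra.

(** * The half-line profiles *)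

Section Profile.
Context {R : realType} (B : R -> R) (be : R) (h : bool -> R -> R) (e0 : R).
Hypotheses (tB : tame B) (Bom : forall y, om y ^+ 2 <= B y).
Hypothesis hbe : 2 * tail B 0 <= be.
Hypothesis be1 : 1 <= be.
Hypothesis ch : forall i, continuous (h i).
Hypothesis hB : forall i y, `|h i y| <= om y ^+ 5 * B y.
Let G0 := tail (h true) 0 + tail (h false) 0.
Hypotheses (e00 : 0 < e0) (e0_be : 16 * be ^+ 2 * e0 <= 1)
  (e0_G : 8 * be ^+ 2 * e0 <= `|G0|).
Arguments ch : clear implicits.
Implicit Types (k l x y : R) (a : bool -> R -> R) (i : bool).

(* Here h true = g is the forcing seen from the right half-line and h false = g(- .)
   the one seen from the left half-line; l stands for eps. *)
Definition adm l := `|l| <= e0 /\ l * G0 <= 0.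

(** Twice the bound [be |l|] on the linear response; the second half is room for the quadratic term,
    since [rad l ^+ 2 <= |l|] for [|l| <= e0]. *)
Definition rad l := 2 * be * `|l|.

Definition source l a i y := l * h i y - a i y ^+ 2.

(** Evaluation at [|x|] extends the half-line profile evenly, so that continuity and weighted bounds
    hold on the whole line, as [ball_inv] requires. *)
Definition step_a l k a i x := resolv k (fun=> 0) (source l a i) `|x|.

(** The matching condition is imposed on the updated profiles rather than on [a]: their integral
    formula at 0 is what gives the sign of the new [k]. *)
Definition step_k l k a := - (step_a l k a true 0 + step_a l k a false 0) / 2.

Definition ball_inv (r : R) k a := [/\ 0 <= k, k <= r,
  forall i, continuous (a i) & forall i x, `|a i x| <= r * om x ^+ 5].

Let be0 : 0 <= be. Proof. exact: le_trans be1. Qed.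

Lemma rad_le l : `|l| <= e0 -> 8 * be * rad l <= 1.
Proof.
move=> le0.
have : be ^+ 2 * `|l| <= be ^+ 2 * e0 by rewrite ler_wpM2l// exprn_ge0.
have -> : 8 * be * rad l = 16 * (be ^+ 2 * `|l|) by rewrite /rad; ring.
have : 16 * (be ^+ 2 * e0) <= 1 by rewrite mulrA.
by lra.
Qed.

Lemma rad_ge0 l : 0 <= rad l.
Proof. by rewrite /rad !mulr_ge0. Qed.

Lemma rad_sqr l : `|l| <= e0 -> rad l ^+ 2 <= `|l|.
Proof.
move=> le0; have h1 := rad_le le0; have l0 := normr_ge0 l.
have r0 := rad_ge0 l; have b1 := be1.
have : 8 * be * rad l * `|l| <= `|l| by rewrite ler_piMl.
have -> : rad l ^+ 2 = 2 * be * rad l * `|l| by rewrite expr2 {2}/rad; ring.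
have : 0 <= be * rad l * `|l| by rewrite !mulr_ge0//; lra.
by nra.
Qed.

Lemma rad_le1 l : `|l| <= e0 -> rad l <= 1.
Proof.
move=> le0; have h1 := rad_le le0; have r0 := rad_ge0 l; have b1 := be1.
by nra.
Qed.

Lemma small0 : small (fun _ : R => 0).
Proof. by split; [exact: contC|move=> y _; rewrite normr0]. Qed.

Lemma tame_h i : tame (h i).
Proof.
apply: (tame_le (c := 1) tB (ch i)) => y _; apply: (le_trans (hB i y)).
by rewrite ler_wpM2r ?(B_ge0 Bom)// omX_le1.
Qed.

Lemma ball_tame r k a i : ball_inv r k a -> tame (a i).
Proof.
move=> [k0 kr ca ab]; have r0 := le_trans k0 kr.
apply: (tame_le (c := r) tB (ca i)) => y _; apply: (le_trans (ab i y)).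
rewrite ler_wpM2l//; apply: le_trans (Bom y); exact: omX_le.
Qed.

(** Squaring leaves powers of [om] to spare: [om^10 <= om^5 om^2 <= om^5 B]. So [a^2] obeys the same
    kind of bound as the forcing. *)
Lemma ball_sqr_le r k a i y : ball_inv r k a ->
  a i y ^+ 2 <= r ^+ 2 * om y ^+ 5 * B y.
Proof.
move=> [k0 kr _ ab]; have r0 := le_trans k0 kr.
rewrite -real_normK ?num_real//.
apply: (@le_trans _ _ ((r * om y ^+ 5) ^+ 2)).
  by apply: lerXn2r; rewrite ?nnegrE ?ab// mulr_ge0 ?omX_ge0.
rewrite exprMn -mulrA ler_wpM2l ?sqr_ge0// -exprM.
apply: (@le_trans _ _ (om y ^+ 5 * om y ^+ 2)).
  by rewrite -exprD; exact: omX_le.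
by rewrite ler_wpM2l ?omX_ge0.
Qed.

Lemma ball_tame_sqr r k a i : ball_inv r k a -> tame (fun y => a i y ^+ 2).
Proof.
move=> ba; have [_ _ ca _] := ba.
apply: (tame_le (c := r ^+ 2) tB (contX (ca i))) => y _.
rewrite ger0_norm ?sqr_ge0//; apply: (le_trans (ball_sqr_le i y ba)).
by rewrite ler_wpM2r ?(B_ge0 Bom)// ler_piMr ?sqr_ge0// omX_le1.
Qed.

Lemma continuous_source r l k a i : ball_inv r k a -> continuous (source l a i).
Proof.
move=> [_ _ ca _]; apply: contB; last exact/contX.
by apply: contM; [exact: contC|exact: ch].
Qed.

Lemma source_le r l k a i y : ball_inv r k a ->
  `|source l a i y| <= (`|l| + r ^+ 2) * om y ^+ 5 * B y.
Proof.
move=> ba; apply: (le_trans (ler_normB _ _)).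
rewrite normrM (ger0_norm (sqr_ge0 _)) !mulrDl.
apply: lerD; last exact: ball_sqr_le ba.
by rewrite -mulrA ler_wpM2l.
Qed.

Lemma tame_source r l k a i : ball_inv r k a -> tame (source l a i).
Proof.
move=> ba; have cs := continuous_source (l := l) (i := i) ba.
apply: (tame_le (c := `|l| + r ^+ 2) tB cs) => y _.
apply: (le_trans (source_le l i y ba)).
rewrite ler_wpM2r ?(B_ge0 Bom)// ler_piMr ?omX_le1//.
by rewrite addr_ge0// sqr_ge0.
Qed.

Lemma step_a_le r l k a i x : ball_inv r k a ->
  `|step_a l k a i x| <= (`|l| + r ^+ 2) * be * om x ^+ 5.
Proof.
move=> ba; have [k0 _ _ _] := ba.
rewrite -om_norm; apply: (resolv_le tB Bom hbe) => //.
- exact: small0.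
- exact: tame_source ba.
- by rewrite addr_ge0// sqr_ge0.
- by move=> y _; exact: source_le ba.
Qed.

Lemma continuous_step_a r l k a i : ball_inv r k a -> continuous (step_a l k a i).
Proof.
move=> ba; have [k0 _ _ _] := ba.
apply: cont_comp; last exact: norm_continuous.
apply: continuous_resolv => //; [exact: small0|exact: tame_source ba].
Qed.

Lemma om0 n : om (0 : R) ^+ n = 1.
Proof. by rewrite /om normr0 addr0 invr1 expr1n. Qed.

(* One power of om less than in ball_inv: it pays for the factor y - x that
   appears when the kernel exp(- 2k(y - x)) is differentiated in k. *)
Definition close (d : R) k1 a1 k2 a2 :=
  `|k1 - k2| <= d /\ forall i x, `|a1 i x - a2 i x| <= d * om x ^+ 4.

Lemma source_dist r d l1 l2 k1 a1 k2 a2 i y :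
  ball_inv r k1 a1 -> ball_inv r k2 a2 -> close d k1 a1 k2 a2 ->
  `|source l1 a1 i y - source l2 a2 i y| <=
    (`|l1 - l2| + 2 * r * d) * om y ^+ 4 * B y.
Proof.
move=> [k10 k1r _ ab1] [_ _ _ ab2] [dk da]; have r0 := le_trans k10 k1r.
have d0 : 0 <= d by exact: le_trans dk.
have -> : source l1 a1 i y - source l2 a2 i y =
    (l1 - l2) * h i y - (a1 i y - a2 i y) * (a1 i y + a2 i y).
  by rewrite /source; ring.
apply: (le_trans (ler_normB _ _)); rewrite !normrM 2!mulrDl.
apply: lerD.
  rewrite -mulrA ler_wpM2l//; apply: (le_trans (hB i y)).
  by rewrite ler_wpM2r ?(B_ge0 Bom)// omX_le.
have s : `|a1 i y + a2 i y| <= 2 * r * om y ^+ 5.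
  apply: (le_trans (ler_normD _ _)).
  by have := ab1 i y; have := ab2 i y; lra.
apply: (le_trans (ler_pM _ _ (da i y) s)) => //.
have -> : d * om y ^+ 4 * (2 * r * om y ^+ 5) =
  2 * r * d * om y ^+ 4 * om y ^+ 5 by ring.
apply: ler_wpM2l; first by apply: mulr_ge0; [rewrite !mulr_ge0|exact: omX_ge0].
by apply: le_trans (Bom y); exact: omX_le.
Qed.

(** The ratio 1/2 is 1/4 + 1/4. The change of kernel contributes
    [2 be (|l1| + r^2) <= 4 be^2 e0 <= 1/4], which is the origin of the 16 in [e0_be], and the
    quadratic term contributes [2 be r <= 1/4]. *)
Lemma step_a_dist d l1 l2 r k1 a1 k2 a2 i x :
  `|l1| <= e0 -> r ^+ 2 <= e0 -> 8 * be * r <= 1 ->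
  ball_inv r k1 a1 -> ball_inv r k2 a2 -> close d k1 a1 k2 a2 ->
  `|step_a l1 k1 a1 i x - step_a l2 k2 a2 i x| <=
    (be * `|l1 - l2| + d / 2) * om x ^+ 4.
Proof.
move=> l1e re rb b1 b2 c12; have [k10 k1r _ _] := b1; have [k20 _ _ _] := b2.
have r0 := le_trans k10 k1r; have [dk _] := c12.
have d0 : 0 <= d by exact: le_trans dk.
have D0 := normr_ge0 (l1 - l2).
rewrite -om_norm.
have := @resolv_dist _ _ _ tB Bom hbe 4 (`|l1| + r ^+ 2) (`|l1 - l2| + 2 * r * d)
  d 0 k1 k2 (fun=> 0) (fun=> 0) (source l1 a1 i) (source l2 a2 i) `|x|
  k10 k20 small0 small0 (tame_source _ _ b1) (tame_source _ _ b2)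
  (normr_ge0 _).
move=> H; apply: (le_trans (H _ _ dk _ _ _)).
- by rewrite addr_ge0// sqr_ge0.
- by rewrite addr_ge0// !mulr_ge0.
- by move=> y _; rewrite subrr normr0.
- by move=> y _; exact: source_le b1.
- by move=> y _; exact: source_dist b1 b2 c12.
rewrite ler_wpM2r ?omX_ge0//.
have bb := be1; have eb := e0_be.
have h1 : be * (`|l1| + r ^+ 2) <= 1 / 8.
  apply: (@le_trans _ _ (be * (2 * e0))); first by rewrite ler_wpM2l//; lra.
  have : be * e0 <= be ^+ 2 * e0 by apply: ler_wpM2r; [exact: ltW|rewrite expr2 ler_peMl].
  by move: e0_be; lra.
have h2 : d * (be * (`|l1| + r ^+ 2)) <= d * (1 / 8) by rewrite ler_wpM2l.
have h3 : d * (8 * be * r) <= d * 1 by rewrite ler_wpM2l.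
by nra.
Qed.

Lemma step_k_dist d l1 l2 r k1 a1 k2 a2 :
  `|l1| <= e0 -> r ^+ 2 <= e0 -> 8 * be * r <= 1 ->
  ball_inv r k1 a1 -> ball_inv r k2 a2 -> close d k1 a1 k2 a2 ->
  `|step_k l1 k1 a1 - step_k l2 k2 a2| <= be * `|l1 - l2| + d / 2.
Proof.
move=> l1e re rb b1 b2 c12; rewrite /step_k.
have := step_a_dist l2 true 0 l1e re rb b1 b2 c12.
have := step_a_dist l2 false 0 l1e re rb b1 b2 c12.
rewrite om0 mulr1.
move: (step_a _ _ _ _ _) (step_a l1 _ _ true _) (step_a _ _ _ _ _) (step_a _ _ _ _ _).
by move=> p1 p2 p3 p4; rewrite !ler_norml; lra.
Qed.

(** The delicate point is that the new [k] is nonnegative. Replacing the kernel by its value at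
    [k = 0] costs [2 k be |l|] on each side, [4 k be |l|] in all; with [k <= 2 be |l|] this is at
    most [|l| |G0|] by [e0_G], which explains the 8 there. *)
Lemma step_inv l k a : adm l -> ball_inv (rad l) k a ->
  ball_inv (rad l) (step_k l k a) (step_a l k a).
Proof.
move=> [le0 lG] ba; have [k0 kr _ _] := ba; have b1 := be1.
have cr : (`|l| + rad l ^+ 2) * be <= rad l.
  by have := rad_sqr le0; rewrite /rad; nra.
have sa i x : `|step_a l k a i x| <= rad l * om x ^+ 5.
  by apply: (le_trans (step_a_le l i x ba)); rewrite ler_wpM2r ?omX_ge0.
split => //; last by move=> i; exact: continuous_step_a ba.
- (* The quadratic terms have a sign, and l * G0 <= 0 dominates the error. *)
  have st i : step_a l k a i 0 <= l * tail (h i) 0 + 2 * k * be * `|l|.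
    rewrite /step_a normr0; have -> : source l a i = fun y => l * h i y - 1 * a i y ^+ 2.
      by apply/funext => y; rewrite mul1r.
    rewrite resolv_lin//; [|exact: small0|exact: tame_h|exact: ball_tame_sqr ba].
    have : 0 <= resolv k (fun=> 0) (fun y => a i y ^+ 2) 0.
      by apply: resolv_ge0 => y _; exact: sqr_ge0.
    have := @resolv_dist _ _ _ tB Bom hbe 4 1 0 k 0 k 0 (fun=> 0) (fun=> 0) (h i)
      (h i) 0 k0 (lexx 0) small0 small0 (tame_h i) (tame_h i) (lexx 0) ler01 (lexx 0).
    rewrite subr0 (ger0_norm k0) => /(_ (lexx k)) H.
    have {}H : `|resolv k (fun=> 0) (h i) 0 - tail (h i) 0| <= 2 * k * be.
      rewrite -resolv00; apply: le_trans (H _ _ _) _.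
      - by move=> y _; rewrite subrr normr0.
      - by move=> y _; rewrite mul1r; exact: hB.
      - by move=> y _; rewrite subrr normr0 !mul0r.
      - by rewrite om0; lra.
    have : `|l * (resolv k (fun=> 0) (h i) 0 - tail (h i) 0)| <= `|l| * (2 * k * be).
      by rewrite normrM ler_wpM2l.
    by rewrite ler_norml => /andP[_]; lra.
  have := st true; have := st false; rewrite /step_k => s1 s2.
  have lG' : l * G0 = - (`|l| * `|G0|) by rewrite -normrM ler0_norm// opprK.
  have : `|l| * (4 * k * be) <= `|l| * `|G0|.
    rewrite ler_wpM2l//; apply: le_trans e0_G.
    have : be * k <= be * rad l by rewrite ler_wpM2l.
    have : be ^+ 2 * `|l| <= be ^+ 2 * e0 by rewrite ler_wpM2l// exprn_ge0.
    have -> : be * rad l = 2 * (be ^+ 2 * `|l|) by rewrite /rad; ring.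
    by lra.
  by move: lG'; rewrite /G0 mulrDr; lra.
- have := sa true 0; have := sa false 0; rewrite om0 mulr1 !ler_norml /step_k.
  by lra.
Qed.

Lemma ball_inv_le r r' k a : r <= r' -> ball_inv r k a -> ball_inv r' k a.
Proof.
move=> rr [k0 kr ca ab]; split => //; first exact: le_trans rr.
by move=> i x; apply: (le_trans (ab i x)); rewrite ler_wpM2r ?omX_ge0.
Qed.

Definition sol l k a := [/\ ball_inv (rad l) k a,
  forall i x, a i x = step_a l k a i x & k = step_k l k a].

(** Picard iteration from zero. The iterates stay in the ball with weight [om^5] but are Cauchy in
    the weaker distance [close]. Pointwise limits keep the bounds of the ball, the uniform rate
    gives continuity, and the contraction estimate against the limit gives the fixed-point
    equations. *)
Lemma sol_exists l : adm l -> exists k a, sol l k a.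
Proof.
move=> al; have [le0 _] := al.
have r2 : rad l ^+ 2 <= e0 by apply: (le_trans _ le0); exact: rad_sqr.
have rb := rad_le le0; have r0 := rad_ge0 l.
pose step (X : R * (bool -> R -> R)) := (step_k l X.1 X.2, step_a l X.1 X.2).
pose X n := iter n step (0, fun _ _ => 0).
have inv n : ball_inv (rad l) (X n).1 (X n).2.
  elim: n => [|n IH]; last exact: step_inv.
  split => //= i; first exact: contC.
  by move=> x; rewrite normr0 mulr_ge0 ?omX_ge0.
have cl n : close (rad l / 2 ^+ n) (X n.+1).1 (X n.+1).2 (X n).1 (X n).2.
  elim: n => [|n IH].
    have [k0 kr _ ab] := inv 1%N; rewrite expr0 divr1; split.
      by rewrite [(X 0%N).1]/= subr0 ger0_norm.
    move=> i x; rewrite [(X 0%N).2]/= subr0; apply: (le_trans (ab i x)).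
    by rewrite ler_wpM2l// omX_le.
  have -> : rad l / 2 ^+ n.+1 = be * `|l - l| + rad l / 2 ^+ n / 2.
    by rewrite subrr normr0 mulr0 add0r exprS invfM; ring.
  split; first exact: step_k_dist le0 r2 rb (inv _) (inv _) IH.
  by move=> i x; exact: step_a_dist le0 r2 rb (inv _) (inv _) IH.
have [k hk] : exists k, forall n, `|(X n).1 - k| <= 2 * rad l / 2 ^+ n.
  by apply: geometric_cauchy => n; have [] := cl n.
have ex_a (p : bool * R) : exists v, forall n,
    `|(X n).2 p.1 p.2 - v| <= 2 * (rad l * om p.2 ^+ 4) / 2 ^+ n.
  apply: geometric_cauchy => n; have [_ /(_ p.1 p.2)] := cl n.
  by rewrite [in leRHS]mulrAC.
have [v hv] := choice ex_a.
pose a i x := v (i, x).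
have ha n i x : `|(X n).2 i x - a i x| <= 2 * rad l / 2 ^+ n * om x ^+ 4.
  by apply: (le_trans (hv (i, x) n)); rewrite le_eqVlt; apply/orP; left; apply/eqP; ring.
have ba : ball_inv (rad l) k a.
  split.
  - rewrite -oppr_le0; apply: (@le_geometric _ _ _ (2 * rad l)) => n.
    have [k0 _ _ _] := inv n; have := hk n; rewrite ler_norml => /andP[].
    by lra.
  - apply: (@le_geometric _ _ _ (2 * rad l)) => n.
    have [_ kr _ _] := inv n; have := hk n; rewrite ler_norml => /andP[].
    by lra.
  - move=> i; apply: (@continuous_geometric_limit _ (fun n => (X n).2 i) _ (2 * rad l)).
      by move=> n; have [_ _ ca _] := inv n.
    move=> n x; apply: (le_trans (ha n i x)).
    by rewrite ler_piMr ?omX_le1// divr_ge0 ?mulr_ge0// exprn_ge0.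
  - move=> i x; apply: (@le_geometric _ _ _ (2 * rad l * om x ^+ 4)) => n.
    have [_ _ _ /(_ i x) ab] := inv n; have := ha n i x.
    rewrite distrC => h1; have := ler_normD ((X n).2 i x) (a i x - (X n).2 i x).
    have -> : 2 * rad l * om x ^+ 4 / 2 ^+ n = 2 * rad l / 2 ^+ n * om x ^+ 4 by ring.
    by rewrite addrC subrK; lra.
have cX n : close (2 * rad l / 2 ^+ n) (X n).1 (X n).2 k a.
  by split; [exact: hk|exact: ha].
have half n : 2 * rad l / 2 ^+ n.+1 = 2 * rad l / 2 ^+ n / 2.
  by rewrite exprS invfM; ring.
exists k, a; split => //.
- move=> i x; apply/eqP; rewrite -subr_eq0 -normr_le0.
  apply: (@le_geometric _ _ _ (2 * rad l * om x ^+ 4)) => n; rewrite add0r.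
  have -> : 2 * rad l * om x ^+ 4 / 2 ^+ n = 2 * rad l / 2 ^+ n * om x ^+ 4 by ring.
  have := ha n.+1 i x; rewrite half.
  have := step_a_dist l i x le0 r2 rb (inv n) ba (cX n).
  rewrite subrr normr0 mulr0 add0r distrC => h1 h2.
  have := ler_normB (step_a l (X n).1 (X n).2 i x - step_a l k a i x)
    ((X n.+1).2 i x - a i x).
  rewrite -[(X n.+1).2 i x]/(step_a l (X n).1 (X n).2 i x) in h2 *.
  rewrite opprB addrACA addrA [X in `|X|](_ : _ = a i x - step_a l k a i x); last ring.
  by rewrite distrC in h1; lra.
- apply/eqP; rewrite -subr_eq0 -normr_le0.
  apply: (@le_geometric _ _ _ (2 * rad l)) => n; rewrite add0r.
  have := hk n.+1; rewrite half.
  have := step_k_dist l le0 r2 rb (inv n) ba (cX n).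
  rewrite subrr normr0 mulr0 add0r => h1 h2.
  have := ler_normB (step_k l (X n).1 (X n).2 - step_k l k a) ((X n.+1).1 - k).
  rewrite -[(X n.+1).1]/(step_k l (X n).1 (X n).2) in h2 *.
  rewrite [X in `|X|](_ : _ = k - step_k l k a); last ring.
  by lra.
Qed.

Let rE := rad e0.

Let abs_e0 : `|e0| <= e0. Proof. by rewrite gtr0_norm. Qed.

Lemma sol_ball l k a : adm l -> sol l k a -> ball_inv rE k a.
Proof.
move=> [le0 _] [ba _ _]; apply: ball_inv_le ba.
by rewrite /rE /rad (gtr0_norm e00) ler_wpM2l ?mulr_ge0.
Qed.

(** Two fixed points at distance [d] are also at distance [be |l1 - l2| + d / 2]. Iterated from a
    crude bound by the radius, this leaves the fixed point [2 be |l1 - l2|] of that map. *)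
Lemma sol_close l1 l2 k1 a1 k2 a2 : adm l1 -> adm l2 ->
  sol l1 k1 a1 -> sol l2 k2 a2 -> close (2 * be * `|l1 - l2|) k1 a1 k2 a2.
Proof.
move=> ad1 ad2 s1 s2; have b1 := sol_ball ad1 s1; have b2 := sol_ball ad2 s2.
have [l1e _] := ad1; have [_ e1 f1] := s1; have [_ e2 f2] := s2.
have r0 : 0 <= rE by exact: rad_ge0.
have r2 : rE ^+ 2 <= e0 by rewrite -[leRHS]gtr0_norm//; exact: rad_sqr.
have rb := rad_le abs_e0; have := normr_ge0 (l1 - l2); set D := `|l1 - l2| => D0.
have cl n : close (2 * be * D + 2 * rE / 2 ^+ n) k1 a1 k2 a2.
  elim: n => [|n IH].
    have bD : 0 <= 2 * be * D by rewrite !mulr_ge0.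
    have [k10 k1r _ ab1] := b1; have [k20 k2r _ ab2] := b2.
    rewrite expr0 divr1; split; first by rewrite ler_norml; lra.
    move=> i x; apply: (le_trans (ler_normB _ _)).
    apply: (@le_trans _ _ (2 * rE * om x ^+ 5)).
      by have := ab1 i x; have := ab2 i x; lra.
    apply: ler_pM; [by rewrite mulr_ge0|exact: omX_ge0| |exact: omX_le].
    by rewrite lerDr.
  have -> : 2 * be * D + 2 * rE / 2 ^+ n.+1 =
      be * D + (2 * be * D + 2 * rE / 2 ^+ n) / 2.
    by rewrite exprS invfM; field.
  split; first by rewrite f1 f2; exact: step_k_dist l1e r2 rb b1 b2 IH.
  by move=> i x; rewrite e1 e2; exact: step_a_dist l1e r2 rb b1 b2 IH.
split; first by apply: (@le_geometric _ _ _ (2 * rE)) => n; case: (cl n).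
move=> i x; apply: (@le_geometric _ _ _ (2 * rE * om x ^+ 4)) => n.
by case: (cl n) => _ /(_ i x)/le_trans; apply; rewrite le_eqVlt; apply/orP; left;
  apply/eqP; ring.
Qed.

Lemma sol_step l k a i x : sol l k a -> 0 <= x ->
  a i x = resolv k (fun=> 0) (source l a i) x.
Proof. by move=> [_ -> _] x0; rewrite /step_a ger0_norm. Qed.

(** It is the resolvent that is differentiated: [a i] agrees with it for [x >= 0], but its even
    extension may have a corner at 0. *)
Lemma sol_riccati l k a i x : sol l k a -> 0 <= x ->
  is_derive x 1 (resolv k (fun=> 0) (source l a i))
    (2 * k * a i x + a i x ^+ 2 - l * h i x).
Proof.
move=> s x0; have [ba _ _] := s; have [k0 _ _ _] := ba.
have d0 : is_derive x 1 (fun _ : R => 0 : R) 0 by exact: is_derive_cst.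
apply: (is_derive_eq (is_derive_resolv k0 small0 (tame_source l i ba) d0)).
by rewrite -(sol_step _ s x0) /source; ring.
Qed.

Lemma sol_match l k a : sol l k a -> 2 * k = - (a true 0 + a false 0).
Proof. by move=> [_ ea ek]; rewrite !ea {1}ek /step_k; field. Qed.

(** * The difference of two solutions *)

(** The exponent of the integrating factor: [a1^2 - a2^2 = (a1 + a2)(a1 - a2)] makes the equation
    for [a1 - a2] linear with coefficient [2 k1 - S'], where [S' = -(a1 + a2)]. *)
Definition Ssum a1 a2 i := tail (fun y => a1 i y + a2 i y : R).

Let rE0 : 0 <= rE. Proof. exact: rad_ge0. Qed.

Let rE1 : rE <= 1. Proof. exact: rad_le1. Qed.

Let rEbe : 8 * be * rE <= 1. Proof. exact: rad_le. Qed.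

(** This accounts for the exponent 5. Two powers go into [B], so [speed_resp] decays like [om^3];
    varying its kernel costs one more, and the remaining [om^2] is still integrable, being bounded
    by [B]. *)
Lemma ball_weight k a i y : ball_inv rE k a -> `|a i y| <= rE * om y ^+ 3 * B y.
Proof.
move=> [_ _ _ ab]; apply: (le_trans (ab i y)); rewrite -mulrA ler_wpM2l//.
rewrite (exprD (om y) 3 2); apply: ler_wpM2l => //; exact: omX_ge0.
Qed.

Lemma is_derive_Ssum k1 a1 k2 a2 i x : ball_inv rE k1 a1 -> ball_inv rE k2 a2 ->
  is_derive x 1 (Ssum a1 a2 i) (- (a1 i x + a2 i x)).
Proof.
move=> b1 b2; exact: is_derive_tail (tameD (ball_tame i b1) (ball_tame i b2)).
Qed.

Lemma small_Ssum k1 a1 k2 a2 i : ball_inv rE k1 a1 -> ball_inv rE k2 a2 ->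
  small (Ssum a1 a2 i).
Proof.
move=> b1 b2; split.
  exact: is_derive_cont (fun x => is_derive_Ssum i x b1 b2).
move=> y y0.
have c0 : 0 <= 2 * rE by rewrite mulr_ge0.
have tt := tameD (ball_tame i b1) (ball_tame i b2).
have h1 z : y <= z -> `|a1 i z + a2 i z| <= 2 * rE * om z ^+ 3 * B z.
  move=> _; apply: (le_trans (ler_normD _ _)).
  by have := ball_weight i z b1; have := ball_weight i z b2; lra.
apply: (le_trans (tail_le tB Bom hbe tt y0 c0 h1)).
apply: (@le_trans _ _ (2 * rE * 1 * (be / 2))).
  by rewrite ler_wpM2r ?divr_ge0// ler_wpM2l// omX_le1.
by have := rEbe; lra.
Qed.

(* The coefficients of eps1 - eps2 and of - 2 (k1 - k2) in sol_diff. *)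
Definition forcing_resp k1 a1 a2 i := resolv k1 (Ssum a1 a2 i) (h i).
Definition speed_resp k1 a1 a2 i := resolv k1 (Ssum a1 a2 i) (a2 i).

Lemma h_weight i y : `|h i y| <= 1 * om y ^+ 5 * B y.
Proof. by rewrite mul1r; exact: hB. Qed.

Lemma forcing_resp_le k1 a1 k2 a2 i x : ball_inv rE k1 a1 -> ball_inv rE k2 a2 ->
  0 <= x -> `|forcing_resp k1 a1 a2 i x| <= be * om x ^+ 5.
Proof.
move=> b1 b2 x0; have [k10 _ _ _] := b1; rewrite -[be]mul1r.
apply: (resolv_le tB Bom hbe k10 (small_Ssum i b1 b2) (tame_h i) x0 ler01).
by move=> y _; exact: h_weight.
Qed.

Lemma speed_resp_le k1 a1 k2 a2 i x : ball_inv rE k1 a1 -> ball_inv rE k2 a2 ->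
  0 <= x -> `|speed_resp k1 a1 a2 i x| <= 1 / 8 * om x ^+ 3.
Proof.
move=> b1 b2 x0; have [k10 _ _ _] := b1.
apply: (@le_trans _ _ (rE * be * om x ^+ 3)).
  apply: (resolv_le tB Bom hbe k10 (small_Ssum i b1 b2) (ball_tame i b2) x0 rE0).
  by move=> y _; exact: ball_weight b2.
by rewrite ler_wpM2r ?omX_ge0//; have := rEbe; lra.
Qed.

Lemma continuous_forcing_resp k1 a1 k2 a2 i : ball_inv rE k1 a1 -> ball_inv rE k2 a2 ->
  continuous (forcing_resp k1 a1 a2 i).
Proof.
move=> b1 b2; have [k10 _ _ _] := b1.
exact: continuous_resolv k10 (small_Ssum i b1 b2) (tame_h i).
Qed.

Lemma continuous_speed_resp k1 a1 k2 a2 i : ball_inv rE k1 a1 -> ball_inv rE k2 a2 ->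
  continuous (speed_resp k1 a1 a2 i).
Proof.
move=> b1 b2; have [k10 _ _ _] := b1.
exact: continuous_resolv k10 (small_Ssum i b1 b2) (ball_tame i b2).
Qed.

Lemma weight2_le (c : R) m y : 0 <= c -> (2 <= m)%N -> c * om y ^+ m <= c * B y.
Proof.
by move=> c0 m2; rewrite ler_wpM2l//; apply: le_trans (Bom y); exact: omX_le.
Qed.

Lemma tame_forcing_resp k1 a1 k2 a2 i : ball_inv rE k1 a1 -> ball_inv rE k2 a2 ->
  tame (forcing_resp k1 a1 a2 i).
Proof.
move=> b1 b2.
have cforcing_resp : continuous (forcing_resp k1 a1 a2 i) by exact: continuous_forcing_resp b1 b2.
apply: (tame_le (c := be) tB cforcing_resp) => y y0.
exact: le_trans (forcing_resp_le i b1 b2 y0) (weight2_le _ _ _).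
Qed.

Lemma tame_speed_resp k1 a1 k2 a2 i : ball_inv rE k1 a1 -> ball_inv rE k2 a2 ->
  tame (speed_resp k1 a1 a2 i).
Proof.
move=> b1 b2.
have cspeed_resp : continuous (speed_resp k1 a1 a2 i) by exact: continuous_speed_resp b1 b2.
apply: (tame_le (c := 1 / 8) tB cspeed_resp) => y y0.
by apply: le_trans (speed_resp_le i b1 b2 y0) (weight2_le _ _ _) => //; lra.
Qed.

(* Subtracting the Riccati equations of two solutions gives a linear equation
   for their difference, whose solution that decays at infinity is explicit. *)
Lemma sol_diff l1 l2 k1 a1 k2 a2 i x : adm l1 -> adm l2 ->
  sol l1 k1 a1 -> sol l2 k2 a2 -> 0 <= x ->
  a1 i x - a2 i x = (l1 - l2) * forcing_resp k1 a1 a2 i x - 2 * (k1 - k2) * speed_resp k1 a1 a2 i x.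
Proof.
move=> ad1 ad2 s1 s2 x0; have b1 := sol_ball ad1 s1; have b2 := sol_ball ad2 s2.
have [k10 _ _ _] := b1; have sS := small_Ssum i b1 b2.
have th := tame_h i; have ta := ball_tame i b2.
set f := fun y => (l1 - l2) * h i y - (2 * (k1 - k2)) * a2 i y.
have tf : tame f by apply: tameB; exact: tameZ.
pose A1 := resolv k1 (fun=> 0) (source l1 a1 i).
pose A2 := resolv k2 (fun=> 0) (source l2 a2 i).
pose W := resolv k1 (Ssum a1 a2 i) f.
have WE y : W y = (l1 - l2) * forcing_resp k1 a1 a2 i y - 2 * (k1 - k2) * speed_resp k1 a1 a2 i y.
  by rewrite /W resolv_lin.
(* [1 / E] solves the homogeneous equation. When [k1 = 0] it is merely bounded, so it is the decay
   of [A1 - A2 - W] that excludes a multiple of it. *)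
pose E y := expR (Ssum a1 a2 i y - 2 * k1 * y).
pose D y := E y * (A1 y - A2 y - W y).
have dD y : 0 <= y -> is_derive y 1 D 0.
  move=> y0; have dA1 := sol_riccati i s1 y0; have dA2 := sol_riccati i s2 y0.
  have dS := is_derive_Ssum i y b1 b2.
  have dW := is_derive_resolv k10 sS tf dS.
  have dL : is_derive y 1 (fun y => Ssum a1 a2 i y - 2 * k1 * y)
      (- (a1 i y + a2 i y) - 2 * k1).
    apply: is_deriveB.
    apply: (is_derive_eq (is_deriveZ (2 * k1) (is_derive_id y 1))).
    by rewrite /GRing.scale/= mulr1.
  have dE := is_derive1_comp (is_derive_expR _) dL.
  apply: (is_derive_eq (is_deriveM dE (is_deriveB (is_deriveB dA1 dA2) dW))).
  rewrite /GRing.scale/= -[(_ - _) y]/(A1 y - A2 y - W y) -/(W y) -/(E y).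
  rewrite (_ : A1 y = a1 i y); last by rewrite (sol_step i s1 y0).
  rewrite (_ : A2 y = a2 i y); last by rewrite (sol_step i s2 y0).
  by rewrite /f; ring.
have Dd y : 0 <= y -> `|D y| <= 2 * (2 * rE + be * `|l1 - l2| + `|k1 - k2|) * om y.
  move=> y0; rewrite /D normrM -mulrA; apply: ler_pM => //.
    rewrite ger0_norm ?expR_ge0//; apply: le_trans expR_half; rewrite ler_expR.
    have := sS.2 y y0; rewrite ler_norml => /andP[_].
    have : 0 <= 2 * k1 * y by rewrite !mulr_ge0.
    by lra.
  rewrite (_ : A1 y = a1 i y); last by rewrite (sol_step i s1 y0).
  rewrite (_ : A2 y = a2 i y); last by rewrite (sol_step i s2 y0).
  have om1 m : (1 <= m)%N -> om y ^+ m <= om y by move=> ?; rewrite -[leRHS]expr1 omX_le.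
  have [_ _ _ /(_ i y) ab1] := b1; have [_ _ _ /(_ i y) ab2] := b2.
  have p := forcing_resp_le i b1 b2 y0; have q := speed_resp_le i b1 b2 y0.
  have h5 : rE * om y ^+ 5 <= rE * om y by rewrite ler_wpM2l ?om1.
  have p5 : `|(l1 - l2) * forcing_resp k1 a1 a2 i y| <= be * `|l1 - l2| * om y.
    rewrite normrM mulrC mulrAC ler_wpM2r//; apply: (le_trans p).
    by rewrite ler_wpM2l ?om1.
  have q3 : `|2 * (k1 - k2) * speed_resp k1 a1 a2 i y| <= `|k1 - k2| * om y.
    rewrite -mulrA normrM ger0_norm// normrM mulrCA ler_wpM2l//.
    apply: (@le_trans _ _ (2 * (1 / 8 * om y))); last by have := om_ge0 y; lra.
    by rewrite ler_wpM2l//; apply: (le_trans q); rewrite ler_wpM2l ?om1//; lra.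
  rewrite WE; apply: (le_trans (ler_normB _ _)).
  have := ler_normB (a1 i y) (a2 i y).
  have := ler_normB ((l1 - l2) * forcing_resp k1 a1 a2 i y)
    (2 * (k1 - k2) * speed_resp k1 a1 a2 i y).
  by lra.
have /eqP := derive0_decay dD Dd x0.
rewrite mulf_eq0 gt_eqF ?expR_gt0//= subr_eq0 => /eqP.
by rewrite WE (sol_step i s1 x0) (sol_step i s2 x0).
Qed.

Lemma Ssum_dist d k1 a1 k2 a2 k3 a3 k4 a4 i y :
  ball_inv rE k1 a1 -> ball_inv rE k2 a2 -> ball_inv rE k3 a3 -> ball_inv rE k4 a4 ->
  close d k1 a1 k3 a3 -> close d k2 a2 k4 a4 -> 0 <= y ->
  `|Ssum a1 a2 i y - Ssum a3 a4 i y| <= d * be.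
Proof.
move=> b1 b2 b3 b4 [k13 c13] [_ c24] y0.
have d0 : 0 <= d by exact: le_trans k13.
have t12 := tameD (ball_tame i b1) (ball_tame i b2).
have t34 := tameD (ball_tame i b3) (ball_tame i b4).
rewrite /Ssum -tailB//.
have c0 : 0 <= 2 * d by rewrite mulr_ge0.
have H z : y <= z -> `|a1 i z + a2 i z - (a3 i z + a4 i z)| <= 2 * d * om z ^+ 0 * B z.
  move=> _; rewrite opprD addrACA; apply: (le_trans (ler_normD _ _)).
  have := c13 i z; have := c24 i z; have := weight2_le (m := 4) z d0 isT.
  by rewrite expr0; lra.
apply: (le_trans (tail_le tB Bom hbe (tameB t12 t34) y0 c0 H)).
by rewrite expr0; lra.
Qed.

Lemma forcing_resp_dist d k1 a1 k2 a2 k3 a3 k4 a4 i x :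
  ball_inv rE k1 a1 -> ball_inv rE k2 a2 -> ball_inv rE k3 a3 -> ball_inv rE k4 a4 ->
  close d k1 a1 k3 a3 -> close d k2 a2 k4 a4 -> 0 <= x ->
  `|forcing_resp k1 a1 a2 i x - forcing_resp k3 a3 a4 i x| <= 4 * d * be ^+ 2 * om x ^+ 4.
Proof.
move=> b1 b2 b3 b4 c13 c24 x0; have [k13 _] := c13.
have [k10 _ _ _] := b1; have [k30 _ _ _] := b3.
have d0 : 0 <= d by exact: le_trans k13.
have SS y (y0 : 0 <= y) := Ssum_dist i b1 b2 b3 b4 c13 c24 y0.
have := resolv_dist (n := 4) tB Bom hbe k10 k30 (small_Ssum i b1 b2) (small_Ssum i b3 b4)
  (tame_h i) (tame_h i) x0 ler01 (lexx 0) k13 SS.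
move=> H; apply: (le_trans (H _ _)).
- by move=> y _; exact: h_weight.
- by move=> y _; rewrite subrr normr0 !mul0r.
rewrite ler_wpM2r ?omX_ge0// addr0 mul1r expr2 [leRHS]mulrA ler_wpM2r//.
have : d * 1 <= d * be by rewrite ler_wpM2l.
by lra.
Qed.

Lemma speed_resp_dist d k1 a1 k2 a2 k3 a3 k4 a4 i x :
  ball_inv rE k1 a1 -> ball_inv rE k2 a2 -> ball_inv rE k3 a3 -> ball_inv rE k4 a4 ->
  close d k1 a1 k3 a3 -> close d k2 a2 k4 a4 -> 0 <= x ->
  `|speed_resp k1 a1 a2 i x - speed_resp k3 a3 a4 i x| <= 5 * d * be ^+ 2 * om x ^+ 2.
Proof.
move=> b1 b2 b3 b4 c13 c24 x0; have [k13 _] := c13.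
have [k10 _ _ _] := b1; have [k30 _ _ _] := b3.
have d0 : 0 <= d by exact: le_trans k13.
have SS y (y0 : 0 <= y) := Ssum_dist i b1 b2 b3 b4 c13 c24 y0.
have := resolv_dist (n := 2) tB Bom hbe k10 k30 (small_Ssum i b1 b2) (small_Ssum i b3 b4)
  (ball_tame i b2) (ball_tame i b4) x0 rE0 d0 k13 SS.
move=> H; apply: (le_trans (H _ _)).
- by move=> y _; exact: ball_weight b2.
- move=> y _; have [_ /(_ i y) c] := c24; apply: (le_trans c).
  rewrite -mulrA ler_wpM2l// (exprD (om y) 2 2); apply: ler_wpM2l => //.
  exact: omX_ge0.
rewrite ler_wpM2r ?omX_ge0// expr2 [leRHS]mulrA ler_wpM2r//.
have dbe : d * 1 <= d * be by rewrite ler_wpM2l.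
have : rE * (2 * d + 2 * (d * be)) <= 1 * (2 * d + 2 * (d * be)).
  by rewrite ler_wpM2r// addr_ge0// !mulr_ge0.
by lra.
Qed.

(** * Dependence of a chosen family of solutions on eps *)

Section Selection.
Context (K : R -> R) (A : R -> bool -> R -> R).
Hypothesis solKA : forall l, adm l -> sol l (K l) (A l).

Let bK l : adm l -> ball_inv rE (K l) (A l).
Proof. by move=> al; exact: sol_ball al (solKA al). Qed.

Lemma close_le d d' k1 a1 k2 a2 : d <= d' -> close d k1 a1 k2 a2 ->
  close d' k1 a1 k2 a2.
Proof.
move=> dd [c1 c2]; split; first exact: le_trans dd.
by move=> i x; apply: (le_trans (c2 i x)); rewrite ler_wpM2r ?omX_ge0.
Qed.

Lemma close_pair l1 l2 l3 l4 : adm l1 -> adm l2 -> adm l3 -> adm l4 ->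
  let d := 2 * be * (`|l1 - l3| + `|l2 - l4|) in
  close d (K l1) (A l1) (K l3) (A l3) /\ close d (K l2) (A l2) (K l4) (A l4).
Proof.
move=> h1 h2 h3 h4 d; split.
- apply: close_le (sol_close h1 h3 (solKA h1) (solKA h3)).
  by rewrite ler_wpM2l ?mulr_ge0// lerDl.
- apply: close_le (sol_close h2 h4 (solKA h2) (solKA h4)).
  by rewrite ler_wpM2l ?mulr_ge0// lerDr.
Qed.

Lemma tail_weight F (c : R) m : tame F -> 0 <= c -> (2 <= m)%N ->
  (forall y, 0 <= y -> `|F y| <= c * om y ^+ m) -> `|tail F 0| <= c * be.
Proof.
move=> tF c0 m2 Fc.
have H y : 0 <= y -> `|F y| <= c * om y ^+ 0 * B y.
  by move=> y0; rewrite expr0 mulr1; exact: le_trans (Fc y y0) (weight2_le _ _ _).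
apply: (le_trans (tail_le tB Bom hbe tF (lexx 0) c0 H)).
by rewrite expr0 mulr1 ler_wpM2l//; have := be0; lra.
Qed.

Let P0 i l1 l2 := forcing_resp (K l1) (A l1) (A l2) i 0.
Let Q0 i l1 l2 := speed_resp (K l1) (A l1) (A l2) i 0.
Let TP i l1 l2 := tail (forcing_resp (K l1) (A l1) (A l2) i) 0.
Let TQ i l1 l2 := tail (speed_resp (K l1) (A l1) (A l2) i) 0.

(** Any quantity that is Lipschitz for [close] is Lipschitz in the two parameters, because
    [sol_close] bounds that distance by [2 be] times the parameter change. *)
Lemma lip2_bound q (M N : R) : 0 <= M -> 0 <= N ->
  (forall l1 l2, adm l1 -> adm l2 -> `|q l1 l2| <= M) ->
  (forall l1 l2 l3 l4 d, adm l1 -> adm l2 -> adm l3 -> adm l4 -> 0 <= d ->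
    close d (K l1) (A l1) (K l3) (A l3) -> close d (K l2) (A l2) (K l4) (A l4) ->
    `|q l1 l2 - q l3 l4| <= N * d) ->
  lip2 adm q.
Proof.
move=> M0 N0 bq dq; exists (M + N * (2 * be)); split.
- by rewrite addr_ge0// !mulr_ge0.
- by move=> x y /bq H /H /le_trans; apply; rewrite lerDl !mulr_ge0.
- move=> l1 l2 l3 l4 h1 h2 h3 h4; have [c1 c2] := close_pair h1 h2 h3 h4.
  apply: (le_trans (dq _ _ _ _ _ h1 h2 h3 h4 _ c1 c2)).
    by rewrite !mulr_ge0// addr_ge0.
  by rewrite mulrA ler_wpM2r ?addr_ge0// lerDr.
Qed.

Let be2 : 0 <= be ^+ 2. Proof. exact: sqr_ge0. Qed.

Lemma lip2_P0 i : lip2 adm (P0 i).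
Proof.
apply: (lip2_bound be0 (mulr_ge0 (ler0n R 4) be2)).
- move=> l1 l2 /bK b1 /bK b2; have := forcing_resp_le i b1 b2 (lexx 0).
  by rewrite om0 mulr1.
- move=> l1 l2 l3 l4 d /bK b1 /bK b2 /bK b3 /bK b4 d0 c13 c24.
  have := forcing_resp_dist i b1 b2 b3 b4 c13 c24 (lexx 0); rewrite om0 mulr1.
  by rewrite mulrAC.
Qed.

Lemma lip2_Q0 i : lip2 adm (Q0 i).
Proof.
apply: (lip2_bound (ler01 : 0 <= (1 : R)) (mulr_ge0 (ler0n R 5) be2)).
- move=> l1 l2 /bK b1 /bK b2; have := speed_resp_le i b1 b2 (lexx 0).
  by rewrite om0 mulr1 => /le_trans; apply; lra.
- move=> l1 l2 l3 l4 d /bK b1 /bK b2 /bK b3 /bK b4 d0 c13 c24.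
  have := speed_resp_dist i b1 b2 b3 b4 c13 c24 (lexx 0); rewrite om0 mulr1.
  by rewrite mulrAC.
Qed.

Lemma lip2_TP i : lip2 adm (TP i).
Proof.
apply: (lip2_bound (mulr_ge0 be0 be0) (mulr_ge0 (mulr_ge0 (ler0n R 4) be2) be0)).
- move=> l1 l2 /bK b1 /bK b2.
  by apply: (tail_weight (m := 5) (tame_forcing_resp i b1 b2)) => // y; exact: forcing_resp_le b1 b2.
- move=> l1 l2 l3 l4 d /bK b1 /bK b2 /bK b3 /bK b4 d0 c13 c24.
  rewrite /TP -tailB; [|exact: tame_forcing_resp b1 b2|exact: tame_forcing_resp b3 b4].
  have t := tameB (tame_forcing_resp i b1 b2) (tame_forcing_resp i b3 b4).
  apply: (le_trans (tail_weight (c := 4 * d * be ^+ 2) (m := 4) t _ isT _)).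
  + by rewrite !mulr_ge0.
  + by move=> y; exact: forcing_resp_dist b1 b2 b3 b4 c13 c24.
  + by rewrite le_eqVlt; apply/orP; left; apply/eqP; ring.
Qed.

Lemma lip2_TQ i : lip2 adm (TQ i).
Proof.
apply: (lip2_bound be0 (mulr_ge0 (mulr_ge0 (ler0n R 5) be2) be0)).
- move=> l1 l2 /bK b1 /bK b2; rewrite -[leRHS]mul1r.
  apply: (tail_weight (m := 3) (tame_speed_resp i b1 b2)) => // y y0.
  by apply: (le_trans (speed_resp_le i b1 b2 y0)); rewrite ler_wpM2r ?omX_ge0//; lra.
- move=> l1 l2 l3 l4 d /bK b1 /bK b2 /bK b3 /bK b4 d0 c13 c24.
  rewrite /TQ -tailB; [|exact: tame_speed_resp b1 b2|exact: tame_speed_resp b3 b4].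
  have t := tameB (tame_speed_resp i b1 b2) (tame_speed_resp i b3 b4).
  apply: (le_trans (tail_weight (c := 5 * d * be ^+ 2) (m := 2) t _ isT _)).
  + by rewrite !mulr_ge0.
  + by move=> y; exact: speed_resp_dist b1 b2 b3 b4 c13 c24.
  + by rewrite le_eqVlt; apply/orP; left; apply/eqP; ring.
Qed.

Let den l1 l2 := 2 - 2 * Q0 true l1 l2 - 2 * Q0 false l1 l2.

Let den_ge1 l1 l2 : adm l1 -> adm l2 -> 1 <= den l1 l2.
Proof.
move=> /bK b1 /bK b2; have := speed_resp_le true b1 b2 (lexx 0).
have := speed_resp_le false b1 b2 (lexx 0); rewrite om0 mulr1 !ler_norml /den /Q0.
by move=> /andP[_ q1] /andP[_ q2]; lra.
Qed.

(** Subtracting the matching conditions and inserting [sol_diff] at 0 puts [K l1 - K l2] on both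
    sides; solving for it produces [den]. Each [Q0] is at most 1/8, so [den] stays away from 0. *)
Definition divdiff_K l1 l2 := (0 - P0 true l1 l2 - P0 false l1 l2) * (den l1 l2)^-1.

Lemma lip2_divdiff_K : lip2 adm divdiff_K.
Proof.
apply: lip2M.
  apply: lip2B (lip2_P0 false); apply: lip2B (lip2_P0 true); exact: lip2_cst.
apply: lip2V; last exact: den_ge1.
apply: lip2B; last by apply: lip2M (lip2_Q0 false); exact: lip2_cst.
apply: lip2B; first exact: lip2_cst.
by apply: lip2M (lip2_Q0 true); exact: lip2_cst.
Qed.

Lemma divdiff_KE l1 l2 : adm l1 -> adm l2 ->
  K l1 - K l2 = divdiff_K l1 l2 * (l1 - l2).
Proof.
move=> h1 h2; have s1 := solKA h1; have s2 := solKA h2.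
have m1 := sol_match s1; have m2 := sol_match s2.
have dt := sol_diff true h1 h2 s1 s2 (lexx 0).
have df := sol_diff false h1 h2 s1 s2 (lexx 0).
have d0 : den l1 l2 != 0 by rewrite gt_eqF// (lt_le_trans _ (den_ge1 h1 h2)).
have : (K l1 - K l2) * den l1 l2 =
    (0 - P0 true l1 l2 - P0 false l1 l2) * (l1 - l2).
  by rewrite /den /P0 /Q0; lra.
by move/(canRL (mulfK d0)) => ->; rewrite /divdiff_K; ring.
Qed.

Lemma C1_K : C1_on adm K (fun l => divdiff_K l l).
Proof. exact: C1_divdiff lip2_divdiff_K divdiff_KE. Qed.

(** The constant for which the antiderivatives [PhiR] and [PhiL] agree at 0. *)
Definition phase l := (tail (A l true) 0 - tail (A l false) 0) / 2.

Definition divdiff_phase l1 l2 := ((TP true l1 l2 - TP false l1 l2) -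
  2 * divdiff_K l1 l2 * (TQ true l1 l2 - TQ false l1 l2)) * 2^-1.

Lemma lip2_divdiff_phase : lip2 adm divdiff_phase.
Proof.
apply: lip2M; last exact: lip2_cst.
apply: lip2B; first exact: lip2B (lip2_TP _) (lip2_TP _).
apply: lip2M; last exact: lip2B (lip2_TQ _) (lip2_TQ _).
by apply: lip2M lip2_divdiff_K; exact: lip2_cst.
Qed.

Lemma tail_sol_diff i l1 l2 : adm l1 -> adm l2 ->
  tail (A l1 i) 0 - tail (A l2 i) 0 =
  (l1 - l2) * TP i l1 l2 - 2 * (K l1 - K l2) * TQ i l1 l2.
Proof.
move=> h1 h2; have b1 := bK h1; have b2 := bK h2.
have tP := tame_forcing_resp i b1 b2; have tQ := tame_speed_resp i b1 b2.
rewrite -tailB; [|exact: ball_tame b1|exact: ball_tame b2].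
rewrite /TP /TQ -!tailZ// -tailB; [|exact: tameZ..].
by apply: eq_tail => y y0; rewrite (sol_diff i h1 h2 (solKA h1) (solKA h2) y0).
Qed.

Lemma C1_phase : C1_on adm phase (fun l => divdiff_phase l l).
Proof.
apply: C1_divdiff lip2_divdiff_phase _ => l1 l2 h1 h2.
have dt := tail_sol_diff true h1 h2; have df := tail_sol_diff false h1 h2.
rewrite divdiff_KE// in dt df.
rewrite /phase /divdiff_phase -mulrBl.
transitivity (((tail (A l1 true) 0 - tail (A l2 true) 0) -
  (tail (A l1 false) 0 - tail (A l2 false) 0)) / 2); first by ring.
by rewrite dt df; ring.
Qed.

Lemma adm0 : adm 0.
Proof. by split; [rewrite normr0 ltW|rewrite mul0r]. Qed.

Lemma K0 : K 0 = 0.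
Proof.
have [[k0 kr _ _] _ _] := solKA adm0; apply/eqP; rewrite eq_le k0 andbT.
by apply: (le_trans kr); rewrite /rad normr0 mulr0.
Qed.

Lemma A0 : A 0 = fun _ _ => 0.
Proof.
have [[_ _ _ ab] _ _] := solKA adm0; apply/funext => i; apply/funext => x.
apply/eqP; rewrite -normr_le0; apply: (le_trans (ab i x)).
by rewrite /rad normr0 mulr0 mul0r.
Qed.

Lemma tail0 x : tail (fun _ : R => 0 : R) x = 0.
Proof. by rewrite /tail /Rintegral integral0. Qed.

Lemma Ssum0 i : Ssum (A 0) (A 0) i = fun=> 0.
Proof.
apply/funext => x; rewrite /Ssum A0 -[RHS](tail0 x).
by apply: eq_tail => y _; rewrite addr0.
Qed.

Lemma forcing_resp0 i : forcing_resp (K 0) (A 0) (A 0) i = tail (h i).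
Proof. by apply/funext => x; rewrite /forcing_resp Ssum0 K0 resolv00. Qed.

Lemma speed_resp0 i : speed_resp (K 0) (A 0) (A 0) i = fun=> 0.
Proof. by apply/funext => x; rewrite /speed_resp Ssum0 K0 resolv00 A0 tail0. Qed.

Lemma divdiff_K00 : divdiff_K 0 0 = - (G0 / 2).
Proof.
rewrite /divdiff_K /den /Q0 /P0 !speed_resp0 !forcing_resp0 /G0.
by rewrite !mulr0 !subr0; field.
Qed.

(** Fubini's theorem, obtained by differentiation: adding [x tail h x] to the difference of the two
    tails at [x] gives a function with zero derivative that decays. This is how the first moment
    enters the derivative of the phase. *)
Lemma tail_tail i : tail (tail (h i)) 0 = tail (fun y => y * h i y) 0.
Proof.
have hle y : `|h i y| <= 1 * om y ^+ 5 * B y by exact: h_weight.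
have th := tame_h i.
have tle x : 0 <= x -> `|tail (h i) x| <= be * om x ^+ 5.
  move=> x0; apply: (le_trans (tail_le tB Bom hbe th x0 ler01 (fun y _ => hle y))).
  by rewrite mul1r mulrC ler_wpM2r ?omX_ge0//; have := be0; lra.
have ct : continuous (tail (h i)) by exact: is_derive_cont (fun x => is_derive_tail x th).
have tt : tame (tail (h i)).
  apply: (tame_le (c := be) tB ct) => y y0.
  exact: le_trans (tle y y0) (weight2_le _ _ _).
have yle y : 0 <= y -> `|y * h i y| <= 1 * om y ^+ 4 * B y.
  move=> y0; rewrite normrM ger0_norm//.
  apply: (@le_trans _ _ ((1 + y) * (1 * om y ^+ 5 * B y))).
    by apply: ler_pM => //; lra.
  by rewrite !mul1r mulrA om_mul.
have ty : tame (fun y => y * h i y).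
  apply: (tame_le (c := 1) tB (contM cont_id (ch i))) => y y0.
  apply: (le_trans (yle y y0)); rewrite !mul1r.
  by rewrite ler_piMl ?omX_le1// (B_ge0 Bom).
pose D x := tail (tail (h i)) x - tail (fun y => y * h i y) x + x * tail (h i) x.
have dD (x : R) : 0 <= x -> is_derive x 1 D 0.
  move=> _; have d1 := is_derive_tail x tt; have d2 := is_derive_tail x ty.
  have d3 := is_derive_tail x th.
  apply: (is_derive_eq (is_deriveD (is_deriveB d1 d2) (is_deriveM (is_derive_id x 1) d3))).
  by rewrite /GRing.scale/=; ring.
have Dd x : 0 <= x -> `|D x| <= (be * be + be + be) * om x.
  move=> x0; have om1 m : (1 <= m)%N -> om x ^+ m <= om x.
    by move=> ?; rewrite -[leRHS]expr1 omX_le.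
  have e1 : `|tail (tail (h i)) x| <= be * be * om x.
    have H y : x <= y -> `|tail (h i) y| <= be * om y ^+ 3 * B y.
      move=> xy; apply: (le_trans (tle y (le_trans x0 xy))).
      rewrite (exprD (om y) 3 2) mulrA; apply: ler_wpM2l => //.
      by rewrite mulr_ge0// omX_ge0.
    apply: (le_trans (tail_le tB Bom hbe tt x0 be0 H)).
    have : be * be * om x ^+ 3 <= be * be * om x.
      by rewrite ler_wpM2l ?mulr_ge0 ?om1.
    have : 0 <= be * be * om x ^+ 3 by apply: mulr_ge0 (omX_ge0 _ _); exact: mulr_ge0.
    by lra.
  have e2 : `|tail (fun y => y * h i y) x| <= be * om x.
    apply: (le_trans (tail_le tB Bom hbe ty x0 ler01 (fun y xy => yle y (le_trans x0 xy)))).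
    have : be * om x ^+ 4 <= be * om x by rewrite ler_wpM2l ?om1.
    have : 0 <= be * om x ^+ 4 by apply: mulr_ge0 (omX_ge0 _ _).
    by lra.
  have e3 : `|x * tail (h i) x| <= be * om x.
    rewrite normrM ger0_norm//.
    apply: (@le_trans _ _ ((1 + x) * (be * om x ^+ 5))).
      by apply: ler_pM => //; [lra|exact: tle].
    by rewrite mulrCA om_mul// ler_wpM2l// om1.
  apply: (le_trans (ler_normD _ _)).
  have := ler_normB (tail (tail (h i)) x) (tail (fun y => y * h i y) x).
  by lra.
have := derive0_decay dD Dd (lexx 0); rewrite /D mul0r addr0.
by move/eqP; rewrite subr_eq0 => /eqP.
Qed.

Lemma divdiff_phase00 : divdiff_phase 0 0 =
  (tail (fun y => y * h true y) 0 - tail (fun y => y * h false y) 0) / 2.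
Proof.
by rewrite /divdiff_phase /TP /TQ !speed_resp0 !forcing_resp0 !tail0 subr0 mulr0 subr0 !tail_tail.
Qed.

(** * Assembling the solution on the line *)

Hypothesis h_refl : forall x, h false (- x) = h true x.

Let AR l i := resolv (K l) (fun=> 0) (source l (A l) i).

Definition PhiR l x := K l * x + phase l - tail (A l true) x.
Definition PhiL l x := - K l * x - phase l - tail (A l false) (- x).
Definition uR l x := K l + AR l true x.
Definition uL l x := - K l - AR l false (- x).
Definition Phi l := glue0 (PhiR l) (PhiL l).
Definition u l := glue0 (uR l) (uL l).

Let AR_sol l i x : adm l -> 0 <= x -> AR l i x = A l i x.
Proof. by move=> al x0; rewrite (sol_step i (solKA al) x0). Qed.

Let is_derive_lin (c x : R) : is_derive x 1 (fun y => c * y) c.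
Proof.
apply: (is_derive_eq (is_deriveZ c (is_derive_id x 1))).
by rewrite /GRing.scale/= mulr1.
Qed.

Lemma is_derive_compN (f : R -> R) (d x : R) : is_derive (- x) 1 f d ->
  is_derive x 1 (fun y => f (- y)) (- d).
Proof.
move=> df; have dN : is_derive x 1 (fun y : R => - y) (- 1).
  by apply: (is_derive_eq (is_deriveN (is_derive_id x 1))).
apply: (is_derive_eq (is_derive1_comp df dN)).
by rewrite /= mulrN1.
Qed.

Lemma is_derive_Phi l x : adm l -> is_derive x 1 (Phi l) (u l x).
Proof.
move=> al; have ba := bK al.
apply: is_derive_glue0.
- move=> z z0; have dT := is_derive_tail z (ball_tame true ba).
  have dc := is_derive_cst (phase l) z 1.
  apply: (is_derive_eq (is_deriveB (is_deriveD (is_derive_lin (K l) z) dc) dT)).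
  by rewrite /uR AR_sol// addr0 opprK.
- move=> z z0; have nz : 0 <= - z by rewrite oppr_ge0.
  have dT := is_derive_compN (is_derive_tail (- z) (ball_tame false ba)).
  have dc := is_derive_cst (phase l) z 1.
  apply: (is_derive_eq (is_deriveB (is_deriveB (is_derive_lin (- K l) z) dc) dT)).
  by rewrite /uL AR_sol// subr0 opprK.
- by rewrite /PhiR /PhiL oppr0 !mulr0 /phase; field.
- rewrite /uR /uL oppr0 !AR_sol//.
  by have := sol_match (solKA al); lra.
Qed.

(** The right-hand side depends only on [x] and the value of [u], so once [u] matches at 0 its
    derivative matches as well. *)
Lemma is_derive_u l x : adm l ->
  is_derive x 1 (u l) (u l x ^+ 2 - K l ^+ 2 - l * h true x).
Proof.
move=> al.
pose w (f : R -> R) x := f x ^+ 2 - K l ^+ 2 - l * h true x.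
have -> : u l x ^+ 2 - K l ^+ 2 - l * h true x = glue0 (w (uR l)) (w (uL l)) x.
  by rewrite /u /glue0 /w; case: ifP.
apply: is_derive_glue0.
- move=> z z0; have dA := sol_riccati true (solKA al) z0.
  have dc := is_derive_cst (K l) z 1.
  apply: (is_derive_eq (is_deriveD dc dA)).
  by rewrite /w /uR AR_sol//; ring.
- move=> z z0; have nz : 0 <= - z by rewrite oppr_ge0.
  have dA := is_derive_compN (sol_riccati false (solKA al) nz).
  have dc := is_derive_cst (- K l) z 1.
  apply: (is_derive_eq (is_deriveB dc dA)).
  by rewrite /w /uL AR_sol// h_refl; ring.
- rewrite /uR /uL oppr0 !AR_sol//.
  by have := sol_match (solKA al); lra.
- rewrite /w /uR /uL oppr0 !AR_sol//.
  have -> : K l + A l true 0 = - K l - A l false 0.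
    by have := sol_match (solKA al); lra.
  by [].
Qed.

Definition profile l x := Phi l x - (phase l + K l * x) * tanh x.

Lemma profile_classical l : adm l -> classical_solution l (h true)
  (fun x t => profile l x + (phase l + K l * x) * tanh x - omega_nl (K l) * t).
Proof.
move=> al.
have -> : (fun x t => profile l x + (phase l + K l * x) * tanh x - omega_nl (K l) * t) =
    (fun x t => Phi l x - omega_nl (K l) * t).
  by apply/funext => x; apply/funext => t; rewrite /profile subrK.
have d1 y t : is_derive y 1 (fun z => Phi l z - omega_nl (K l) * t) (u l y).
  have dc := is_derive_cst (omega_nl (K l) * t) y 1.
  apply: (is_derive_eq (is_deriveB (is_derive_Phi y al) dc)).
  by rewrite subr0.
have dxE t : (fun y => dx (fun x t => Phi l x - omega_nl (K l) * t) y t) = u l.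
  by apply/funext => y; rewrite /dx derive1E; exact: (derive_val (is_derive := d1 y t)).
move=> x t; rewrite dxE.
have ds : is_derive t 1 (fun s => Phi l x - omega_nl (K l) * s) (- omega_nl (K l)).
  have dc := is_derive_cst (Phi l x) t 1.
  apply: (is_derive_eq (is_deriveB dc (is_derive_lin (omega_nl (K l)) t))).
  by rewrite sub0r.
have du := is_derive_u x al.
split; first exact: (ex_derive (is_derive := ds)).
split; first exact: (ex_derive (is_derive := d1 x t)).
split; first exact: (ex_derive (is_derive := du)).
rewrite /dt derive1E (derive_val (is_derive := ds)).
rewrite derive1E (derive_val (is_derive := du)).
rewrite -[dx _ x t]/((fun y => dx (fun x t => Phi l x - omega_nl (K l) * t) y t) x) dxE.
by rewrite /omega_nl; ring.
Qed.

Lemma one_sub_tanh x : 0 <= x -> 0 <= 1 - tanh x <= 2 * om x ^+ 2.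
Proof.
move=> x0; rewrite /tanh expRN; have := expR_ge1Dx x; set E := expR x => Ex.
have E0 : 0 < E by rewrite expR_gt0.
have -> : 1 - (E - E^-1) / (E + E^-1) = 2 / (E ^+ 2 + 1).
  have n1 : E ^+ 2 + 1 != 0 by rewrite gt_eqF// ltr_wpDl// sqr_ge0.
  have n2 : E + E^-1 != 0 by rewrite gt_eqF// addr_gt0// invr_gt0.
  by field; rewrite n1 gt_eqF.
rewrite divr_ge0 ?addr_ge0 ?sqr_ge0//= ler_wpM2l// /om ger0_norm// exprVn.
rewrite lef_pV2 ?posrE; [|by rewrite ltr_wpDl ?sqr_ge0|by rewrite exprn_gt0// ltr_pwDl].
by nra.
Qed.

Lemma tanhN x : tanh (- x) = - tanh x.
Proof. by rewrite /tanh opprK [X in _ / X]addrC -mulNr opprB. Qed.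

Lemma tail_sol_le l i x : adm l -> 0 <= x -> `|tail (A l i) x| <= om x.
Proof.
move=> al x0; have ba := bK al.
have H y : x <= y -> `|A l i y| <= rE * om y ^+ 3 * B y by move=> _; exact: ball_weight ba.
apply: (le_trans (tail_le tB Bom hbe (ball_tame i ba) x0 rE0 H)).
have h3 : om x ^+ 3 <= om x by rewrite -[leRHS]expr1 omX_le.
have h8 : 8 * be * rE * om x ^+ 3 <= 1 * om x ^+ 3 by rewrite ler_wpM2r ?omX_ge0.
have := om_ge0 x; have := omX_ge0 x 3.
by lra.
Qed.

(** The linear part grows at most like [1 + |x|] and is multiplied by [1 - tanh |x| <= 2 om^2],
    which leaves [2 om]; the tail of the profile adds one more [om]. *)
Lemma profile_le l x : adm l -> `|profile l x| <= 3 * om x.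
Proof.
move=> al; have ba := bK al; have [k0 kr _ _] := ba.
have ph1 : `|phase l| <= 1.
  have := tail_sol_le true al (lexx 0); have := tail_sol_le false al (lexx 0).
  rewrite -(expr1 (om 0)) om0 /phase normrM (ger0_norm (_ : 0 <= 2^-1 :> R))//.
  by have := ler_normB (tail (A l true) 0) (tail (A l false) 0); lra.
have main (i : bool) (s y : R) : `|s| <= 1 -> 0 <= y ->
    `|(K l * y + s) * (1 - tanh y) - tail (A l i) y| <= 3 * om y.
  move=> s1 y0; have /andP[t0 t1] := one_sub_tanh y0.
  apply: (le_trans (ler_normB _ _)).
  have := tail_sol_le i al y0; rewrite normrM (ger0_norm t0).
  have : `|K l * y + s| * (1 - tanh y) <= (1 + y) * (2 * om y ^+ 2).
    apply: ler_pM => //; apply: (le_trans (ler_normD _ _)).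
    rewrite addrC; apply: lerD => //; rewrite normrM !ger0_norm//.
    by rewrite ler_piMl// (le_trans kr).
  by rewrite mulrCA om_mul// expr1; lra.
rewrite /profile /Phi /glue0; have [x0|x0] := leP 0 x.
  have -> : PhiR l x - (phase l + K l * x) * tanh x =
    (K l * x + phase l) * (1 - tanh x) - tail (A l true) x by rewrite /PhiR; ring.
  exact: main.
have -> : PhiL l x - (phase l + K l * x) * tanh x =
    (K l * (- x) + - phase l) * (1 - tanh (- x)) - tail (A l false) (- x).
  by rewrite /PhiL tanhN; ring.
have -> : om x = om (- x) by rewrite /om normrN.
by apply: main; rewrite ?normrN// oppr_ge0 ltW.
Qed.

End Selection.

Lemma profile_family : (forall x, h false (- x) = h true x) ->
  exists (phi0 k phi0' k' : R -> R) (phi : R -> R -> R),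
    C1_on adm phi0 phi0' /\ C1_on adm k k' /\
    phi0' 0 = (tail (fun y => y * h true y) 0 - tail (fun y => y * h false y) 0) / 2 /\
    k' 0 = - (G0 / 2) /\
    (forall l, adm l -> classical_solution l (h true)
       (fun x t => phi l x + (phi0 l + k l * x) * tanh x - omega_nl (k l) * t)) /\
    (forall l x, adm l -> `|phi l x| <= 3 * om x).
Proof.
move=> h_refl.
have ex l : exists p : R * (bool -> R -> R), adm l -> sol l p.1 p.2.
  (* Zero is a default value outside the admissible set, where nothing is claimed. *)
  have [al|nal] := pselect (adm l); last by exists (0, fun _ _ => 0) => /nal.
  by have [k [a s]] := sol_exists al; exists (k, a).
have [p hp] := choice ex.
pose K l := (p l).1; pose A l := (p l).2.
have solKA l : adm l -> sol l (K l) (A l) by exact: hp.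
exists (phase A), K, (fun l => divdiff_phase K A l l), (fun l => divdiff_K K A l l).
exists (profile K A); split; first exact: C1_phase.
split; first exact: C1_K.
split; first exact: divdiff_phase00.
split; first exact: divdiff_K00.
split; first by move=> l al; exact: profile_classical.
by move=> l x al; exact: profile_le.
Qed.

End Profile.

(** * Moments of the forcing *)

Section WholeLine.
Context {R : realType}.
Notation mu := (@lebesgue_measure R).
Implicit Types F : R -> R.

Lemma ge0_reflect F : continuous F -> (forall x, 0 <= F x) ->
  (\int[mu]_(x in `]-oo, 0%R]) (F x)%:E = \int[mu]_(x in `[0%R, +oo[) (F (- x))%:E)%E.
Proof.
move=> cF F0; have := @ge0_integration_by_substitutionNy R F 0.
by rewrite oppr0 => ->//; exact: continuous_subspaceT.
Qed.

Lemma integrable_reflect F : continuous F -> tame (F \o -%R) ->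
  mu.-integrable `]-oo, 0] (EFin \o F).
Proof.
move=> cF [_ /integrableP[_ iF]]; apply/integrableP; split.
  apply/measurable_EFinP/measurable_funTS; exact: continuous_measurable_fun.
have /= -> := ge0_reflect (cont_norm cF) (fun x => normr_ge0 (F x)).
exact: iF.
Qed.

(** The change of variables is made for nonnegative functions and transferred through
    [F = (F + |F|) - |F|]. *)
Lemma Rintegral_reflect F : continuous F -> tame (F \o -%R) ->
  (\int[mu]_(x in `]-oo, 0]) F x)%R = tail (F \o -%R) 0.
Proof.
move=> cF tF; have iF := integrable_reflect cF tF.
have cN := cont_norm cF; have tN := tame_norm tF.
have iN := integrable_reflect cN tN.
have ge0E (G : R -> R) : continuous G -> (forall x, 0 <= G x) ->
    (\int[mu]_(x in `]-oo, 0]) G x)%R = tail (G \o -%R) 0.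
  by move=> cG G0; rewrite /tail /Rintegral ge0_reflect.
have -> : (\int[mu]_(x in `]-oo, 0]) F x)%R =
    (\int[mu]_(x in `]-oo, 0]) ((F x + `|F x|) - `|F x|))%R.
  by apply: eq_Rintegral => x _; rewrite addrK.
rewrite RintegralB//; last exact: (integrableD _ iF iN).
rewrite !ge0E//; last 2 first.
- exact: contD.
- by move=> x; have := ler_norm (- F x); rewrite normrN; lra.
rewrite -tailB//; last exact: (tameD tF tN).
by apply: eq_tail => y _ /=; rewrite addrK.
Qed.

Lemma Rintegral_halves F : continuous F -> tame F -> tame (F \o -%R) ->
  (\int[mu]_x F x)%R = tail F 0 + tail (F \o -%R) 0.
Proof.
move=> cF [_ iF] tN; have iN := integrable_reflect cF tN.
have iN' : mu.-integrable `]-oo, 0[ (EFin \o F).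
  by apply: integrableS iN => //; apply: subset_itvl; rewrite bnd_simp.
have dj : [disjoint (`]-oo, 0[%classic : set R) & `[0, +oo[%classic].
  apply/disj_setPS => y [/=]; rewrite 2!in_itv/= andbT => y0.
  by rewrite leNgt y0.
have UT : setT = `]-oo, 0[ `|` `[0, +oo[ :> set R.
  by rewrite -(@itv_bndbnd_setU _ _ _ (BLeft 0)) ?bnd_simp// set_itvE.
rewrite UT Rintegral_setU//; last exact: continuous_integrable_setU.
by rewrite Rintegral_itv_bndo_bndc// Rintegral_reflect// addrC.
Qed.

End WholeLine.

Section Moments.
Context {R : realType}.
Notation mu := (@lebesgue_measure R).
Implicit Types g dg : R -> R.

(** An indefinite integral is continuous. Continuity of [g] is what makes the tails differentiable
    everywhere and the solution classical. *)
Lemma weak_deriv_continuous g dg : weak_deriv g dg -> continuous g.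
Proof.
move=> wd x; pose a := x - 1; pose b := x + 1.
have ab : a < b by rewrite /a /b; lra.
have [idg _] := wd a b (ltW ab).
have := parameterized_integral_continuous (ltW ab) idg.
move=> /(continuous_within_itvP _ ab)[cI _ _].
have xab : x \in `]a, b[ by rewrite in_itv/= /a /b; apply/andP; split; lra.
have cx := cI x xab.
have E y : a <= y -> g y = g a + parameterized_integral mu a y dg.
  by move=> ay; have [_] := wd a y ay; rewrite /parameterized_integral => <-; ring.
have ax : a < x by rewrite /a; lra.
rewrite /continuous_at (E x (ltW ax)).
apply: cvg_trans (cvgD (cvg_cst (g a)) cx).
apply: near_eq_cvg; near=> y; rewrite /= (E y)//.
by apply/ltW; near: y; exact: lt_nbhsr.
Unshelve. all: by end_near. Qed.

(** Symmetrised so that one weight serves both half-lines. The factor [(1 + |y|)^5] cancels the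
    [om^5] in the bound on the forcing, and the summand [om^2] lets [B] absorb two powers of [om].
    Integrability uses the power 6 of [1 + y^2], supplied by [sigma + 4 > 6]. *)
Definition envelope g y : R := (1 + `|y|) ^+ 5 * (`|g y| + `|g (- y)|) + om y ^+ 2.

Lemma continuous_envelope g : continuous g -> continuous (envelope g).
Proof.
move=> cg; apply: contD; last exact: continuous_omX.
apply: contM.
  apply: contX; apply: contD; [exact: contC|exact: norm_continuous].
apply: contD; apply: cont_norm => //.
by apply: (cont_comp cg); exact: opp_continuous.
Qed.

(* AM-GM against the weight: the square of the left-hand side is at most
   32 v^2 (1 + y^2)^5. *)
Lemma moment_le (v y : R) :
  (1 + `|y|) ^+ 5 * `|v| <= v ^+ 2 * (1 + y ^+ 2) ^+ 6 + 32 * (1 + y ^+ 2)^-1.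
Proof.
set q := 1 + y ^+ 2; have q1 : 1 <= q by rewrite lerDl sqr_ge0.
have q0 : 0 < q by exact: lt_le_trans q1.
set X := v ^+ 2 * q ^+ 6; set Y := 32 * q^-1; set c := _ * `|v|.
have X0 : 0 <= X by rewrite mulr_ge0 ?sqr_ge0// exprn_ge0// ltW.
have Y0 : 0 <= Y by rewrite mulr_ge0// invr_ge0 ltW.
have c0 : 0 <= c by rewrite mulr_ge0// exprn_ge0// addr_ge0.
have XY : X * Y = 32 * v ^+ 2 * q ^+ 5 by rewrite /X /Y; field; rewrite gt_eqF.
have cXY : c ^+ 2 <= X * Y.
  have -> : X * Y = (2 * q) ^+ 5 * v ^+ 2 by rewrite XY; ring.
  rewrite /c exprMn real_normK ?num_real// ler_wpM2r ?sqr_ge0//.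
  have h2 : (1 + `|y|) ^+ 2 <= 2 * q.
    rewrite /q -[y ^+ 2]real_normK ?num_real//.
    by have := sqr_ge0 (1 - `|y|); lra.
  by rewrite -exprM mulnC exprM; apply: lerXn2r; rewrite ?nnegrE ?sqr_ge0// mulr_ge0// ltW.
rewrite -(@ler_pXn2r _ 2)// ?nnegrE ?addr_ge0//.
by apply: (le_trans cXY); rewrite sqrrD; have := sqr_ge0 X; have := sqr_ge0 Y;
  have := mulr_ge0 X0 Y0; lra.
Qed.

Lemma tame_weight g w : continuous g -> 6 <= w -> weighted_L2 w g ->
  tame (fun y => g y ^+ 2 * (1 + y ^+ 2) ^+ 6) /\
  tame (fun y => g (- y) ^+ 2 * (1 + y ^+ 2) ^+ 6).
Proof.
move=> cg w6 [mg ig].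
pose E y := g y ^+ 2 * (1 + y ^+ 2) ^+ 6.
have cE : continuous E.
  apply: contM; first exact: contX.
  by apply: contX; apply: contD; [exact: contC|exact: exprn_continuous].
have E0 y : 0 <= E y by rewrite mulr_ge0 ?sqr_ge0// exprn_ge0// addr_ge0// sqr_ge0.
have mE D : measurable_fun D (EFin \o E).
  apply: measurable_funTS; apply/measurable_EFinP; exact: continuous_measurable_fun.
have iE : (\int[mu]_x (E x)%:E < +oo)%E.
  apply: le_lt_trans ig; apply: ge0_le_integral => //=.
  - by move=> x _; rewrite lee_fin.
  - exact: mE.
  - apply/measurable_EFinP; apply: measurable_funM.
      by apply: measurable_funX.
    apply: (@measurableT_comp _ _ _ _ _ _ (@powR R ^~ w)); first exact: measurable_powR.
    apply: continuous_measurable_fun.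
    by apply: contD; [exact: contC|exact: exprn_continuous].
  - move=> x _; rewrite lee_fin ler_wpM2l ?sqr_ge0//.
    have q1 : 1 <= 1 + x ^+ 2 by rewrite lerDl sqr_ge0.
    by rewrite -powR_mulrn ?ler_powR// (le_trans ler01).
have iD (D : set R) : measurable D -> mu.-integrable D (EFin \o E).
  move=> mD; apply/integrableP; split; first exact: mE.
  have -> : (\int[mu]_(x in D) `|(EFin \o E) x| = \int[mu]_(x in D) (E x)%:E)%E.
    by apply: eq_integral => x _ /=; rewrite ger0_norm.
  apply: (le_lt_trans _ iE); apply: ge0_subset_integral => //; first exact: mE.
  by move=> x _; rewrite lee_fin.
split; first by split; [exact: cE|exact: iD].
have cEN : continuous (E \o -%R) by apply: (cont_comp cE); exact: opp_continuous.
have -> : (fun y => g (- y) ^+ 2 * (1 + y ^+ 2) ^+ 6) = E \o -%R.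
  by apply/funext => y; rewrite /E /= sqrrN.
split => //; apply/integrableP; split.
  by apply: measurable_funTS; apply/measurable_EFinP; exact: continuous_measurable_fun.
have /integrableP[_] := iD `]-oo, 0]%classic (measurable_itv _).
have N0 x : 0 <= `|E x| by [].
have /= -> := ge0_reflect (cont_norm cE) N0.
by [].
Qed.

Lemma tame_oneDsqrV : tame (fun y : R => (1 + y ^+ 2)^-1).
Proof.
have cV : continuous (fun y : R => (1 + y ^+ 2)^-1) by exact: continuous_oneDsqrV.
split => //; apply/integrableP; split.
  by apply/measurable_EFinP; apply: measurable_funTS; exact: continuous_measurable_fun.
apply: (@le_lt_trans _ _ (pi / 2 : R)%:E); last exact: ltry.
rewrite -integral0y_oneDsqr le_eqVlt; apply/orP; left; apply/eqP.
by apply: eq_integral => x _ /=; rewrite ger0_norm// invr_ge0 addr_ge0// sqr_ge0.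
Qed.

Lemma tame_envelope g w : continuous g -> 6 <= w -> weighted_L2 w g ->
  tame (envelope g).
Proof.
move=> cg w6 wg; have [t1 t2] := tame_weight cg w6 wg.
(* 65 = 32 + 32 + 1: one application of [moment_le] for each of [g y] and [g (- y)], and the bound
   on [om^2]. *)
have t3 := tameZ 65 tame_oneDsqrV.
apply: (tame_dom (continuous_envelope cg) (tameD (tameD t1 t2) t3)) => y y0.
have q0 : 0 < 1 + y ^+ 2 by rewrite ltr_pwDl// sqr_ge0.
have om2 : om y ^+ 2 <= (1 + y ^+ 2)^-1.
  rewrite /om ger0_norm// exprVn lef_pV2 ?posrE ?exprn_gt0 ?ltr_pwDl ?sqr_ge0//.
  by rewrite sqrrD expr1n mul1r lerD2r lerDl mulrn_wge0.
rewrite ger0_norm; last first.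
  by rewrite addr_ge0 ?omX_ge0// mulr_ge0 ?exprn_ge0 ?addr_ge0.
have := moment_le (g y) y; have := moment_le (g (- y)) y.
by rewrite /envelope mulrDr; lra.
Qed.

End Moments.

Unset Implicit Arguments.

Theorem theorem3p1 (R : realType) (g : R -> R) (sigma : R) :
  2 < sigma ->
  (exists g' g'' : R -> R,
      weak_deriv g g' /\ weak_deriv g' g'' /\
      weighted_L2 (sigma + 4) g /\ weighted_L2 (sigma + 4) g' /\
      weighted_L2 (sigma + 4) g'') ->
  let g0 := Rintegral lebesgue_measure setT g in
  let g1 := Rintegral lebesgue_measure setT (fun x => x * g x) in
  g0 != 0 ->
  exists eps0 : R, 0 < eps0 /\
  exists (phi0 k phi0' k' : R -> R) (phi : R -> R -> R),
    (* C^1 in eps on the closed-at-0 one-sided interval of admissible eps *)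
    let J := [set e : R | `|e| < eps0 /\ e * g0 <= 0] in
    C1_on J phi0 phi0' /\ C1_on J k k' /\
    phi0' 0 = g1 / 2 /\ k' 0 = - (g0 / 2) /\
    (* for 0 < |eps| < eps0 with sign eps = - sign g0 : a solution *)
    (forall eps : R, 0 < `|eps| < eps0 -> Num.sg eps = - Num.sg g0 ->
       classical_solution eps g
         (fun x t => phi eps x + (phi0 eps + k eps * x) * tanh x
                     - omega_nl (k eps) * t)) /\
    (* |phi(x;eps)| -> 0 as |x| -> oo, uniformly in admissible eps *)
    (forall eta : R, 0 < eta -> exists M : R, forall eps x : R,
       0 < `|eps| < eps0 -> Num.sg eps = - Num.sg g0 ->
       M < `|x| -> `|phi eps x| < eta).
Proof.
move=> sigma2 [g' [g'' [wd [_ [wg _]]]]] g0 g1 g0n0.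
have cg := weak_deriv_continuous wd.
have w6 : 6 <= sigma + 4 by lra.
pose B := envelope g.
have tB : tame B by exact: tame_envelope cg w6 wg.
have Bom y : om y ^+ 2 <= B y.
  by rewrite lerDr mulr_ge0 ?exprn_ge0 ?addr_ge0.
pose be := 1 + 2 * tail B 0.
have tB0 : 0 <= tail B 0.
  by apply: tail_ge0 => y _; apply: le_trans (Bom y); exact: omX_ge0.
have hbe : 2 * tail B 0 <= be by rewrite lerDr.
have be1 : 1 <= be by rewrite lerDl mulr_ge0.
pose h (i : bool) (y : R) := if i then g y else g (- y).
have cgN : continuous (fun y => g (- y)) by apply: (cont_comp cg); exact: opp_continuous.
have ch i : continuous (h i) by case: i.
have hB i y : `|h i y| <= om y ^+ 5 * B y.
  have -> : om y ^+ 5 * B y = `|g y| + `|g (- y)| + om y ^+ 7.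
    rewrite /B /envelope mulrDr mulrA -exprD; congr (_ + _).
    by rewrite -exprMn mulVf ?expr1n ?mul1r// gt_eqF// ltr_pwDl.
  have := omX_ge0 y 7; have := normr_ge0 (g y); have := normr_ge0 (g (- y)).
  by rewrite /h; case: i; lra.
have th i : tame (h i) by exact: (tame_h tB Bom ch hB i).
have g0E : g0 = tail (h true) 0 + tail (h false) 0.
  exact: (Rintegral_halves cg (th true) (th false)).
have tyh i : tame (fun y => y * h i y).
  apply: (tame_dom (contM cont_id (ch i)) tB) => y y0.
  rewrite normrM ger0_norm//; apply: (@le_trans _ _ ((1 + y) * (om y ^+ 5 * B y))).
    by apply: ler_pM => //; lra.
  rewrite mulrA om_mul// ler_piMl ?omX_le1//.
  by apply: le_trans (Bom y); exact: omX_ge0.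
have g1E : g1 = tail (fun y => y * h true y) 0 - tail (fun y => y * h false y) 0.
  have tN : tame ((fun y => y * g y) \o -%R).
    have := tameZ (-1) (tyh false); congr tame; apply/funext => y /=.
    by rewrite /h; ring.
  rewrite /g1 (Rintegral_halves (contM cont_id cg) (tyh true) tN); congr (_ + _).
  rewrite -[RHS]mulN1r -tailZ//; apply: eq_tail => y _ /=.
  by rewrite /h; ring.
have G0 : 0 < `|g0| by rewrite normr_gt0.
have b2 : 0 < be ^+ 2 by rewrite exprn_gt0// (lt_le_trans _ be1).
have b16 : 0 < 16 * be ^+ 2 by apply: mulr_gt0.
have b8 : 0 < 8 * be ^+ 2 by apply: mulr_gt0.
(* The first bound serves the contraction, the second the sign of [k]; the second is positive
   because [g0] is nonzero. *)
pose e0 := Num.min (16 * be ^+ 2)^-1 (`|g0| / (8 * be ^+ 2)).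
have e00 : 0 < e0 by rewrite lt_min invr_gt0 b16 divr_gt0.
have e0_be : 16 * be ^+ 2 * e0 <= 1.
  by rewrite -ler_pdivlMl// mulr1 ge_min lexx.
have e0_G : 8 * be ^+ 2 * e0 <= `|tail (h true) 0 + tail (h false) 0|.
  by rewrite -g0E -ler_pdivlMl// [leRHS]mulrC ge_min lexx orbT.
have h_refl x : h false (- x) = h true x by rewrite /h opprK.
have [phi0 [k [phi0' [k' [phi [C1p [C1k [dp [dk [sol dec]]]]]]]]]] :=
  profile_family tB Bom hbe be1 ch hB e00 e0_be e0_G h_refl.
exists e0; split => //; exists phi0, k, phi0', k', phi => J.
have JJ : J `<=` adm h e0.
  by move=> e [e1 e2]; split; [exact: ltW|rewrite -g0E].
have sJ eps : 0 < `|eps| < e0 -> Num.sg eps = - Num.sg g0 -> adm h e0 eps.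
  move=> /andP[_ ee] sg; apply: JJ; split => //.
  by rewrite -sgr_le0 sgrM sg mulNr oppr_le0 -expr2 sqr_ge0.
split; first exact: C1_on_subset JJ C1p.
split; first exact: C1_on_subset JJ C1k.
split; first by rewrite dp g1E.
split; first by rewrite dk g0E.
split; first by move=> eps e1 e2; exact: sol (sJ eps e1 e2).
move=> eta eta0; exists (3 / eta) => eps x e1 e2 Mx.
apply: (le_lt_trans (dec eps x (sJ eps e1 e2))).
rewrite /om ltr_pdivrMr ?ltr_pwDl// -ltr_pdivrMl// mulrC.
by apply: (lt_trans Mx); rewrite ltrDr.
Qed.
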